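(* Let $\nu$ be a prime polynomial in $R_\infty=\mathbb{F}_q[Y]$ and let $x_0\in X_\infty$ be an $A_\infty$-periodic point. There exists $c'>0$ such that for every $A_\infty$-periodic point $x\in X_\infty$, there exist $\xi\in\Omega$ and $\theta\in\Theta_\xi$ such that $c'\mu_x\le\theta$. In particular, $\theta$ is not absolutely continuous with respect to the homogeneous measure on $X_\infty$.
   Context: Let $q$ be a positive power of a prime $p$, $K=\mathbb{F}_q(Y)$, $R_\infty=\mathbb{F}_q[Y]$, $K_\infty=\mathbb{F}_q((Y^{-1}))$, and $X_\infty=\mathrm{PGL}_2(K_\infty)/\mathrm{PGL}_2(R_\infty)$. Via $g\,\mathrm{PGL}_2(R_\infty)\mapsto [g(R_\infty\times R_\infty)]$, the space $X_\infty$ is the space of homothety classes (under $K_\infty^\times$) of $R_\infty$-lattices in $K_\infty\times K_\infty$, i.e. rank $2$ free $R_\infty$-submodules spanning $K_\infty\times K_\infty$ over $K_\infty$. The homogeneous measure on $X_\infty$ is the $\mathrm{PGL}_2(K_\infty)$-invariant probability measure. Let $A_\infty$ be the diagonal subgroup of $\mathrm{PGL}_2(K_\infty)$, acting on $X_\infty$ on the left. A point $x\in X_\infty$ is $A_\infty$-periodic if its orbit $A_\infty x$ is compact; $\mu_x$ then denotes the unique $A_\infty$-invariant probability measure on $A_\infty x$. For a prime polynomial $\nu\in R_\infty$, the Hecke tree $T_\nu(x_0)$ is the connected component of $x_0$ in the graph with vertex set $X_\infty$, with an edge between two classes whenever they have representatives $\Lambda,\Lambda'$ with $\Lambda'\subset\Lambda$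 and $\Lambda/\Lambda'\cong R_\infty/\nu R_\infty$ as $R_\infty$-modules. It is a regular tree. Let $\Omega$ be its boundary at infinity (set of ends). For $\xi\in\Omega$, $(x_n^\xi)_{n\in\mathbb{N}}$ denotes the sequence of vertices along the geodesic ray in $T_\nu(x_0)$ from $x_0$ to $\xi$. If $x_0$ is $A_\infty$-periodic, all vertices of $T_\nu(x_0)$ are $A_\infty$-periodic. For $\xi\in\Omega$, $\Theta_\xi$ is the set of weak-star accumulation points (tested against continuous functions with compact support) of the sequence of measures $(\mu_{x_n^\xi})_{n\in\mathbb{N}}$ on $X_\infty$. *)

(* Defs.v *)
From HB Require Import structures.
From mathcomp Require Import all_boot all_order all_algebra.
From mathcomp Require Import all_classical all_reals all_analysis.
From mathcomp Require Import zify.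

Set Implicit Arguments.
Unset Strict Implicit.
Unset Printing Implicit Defensive.

Import Order.TTheory GRing.Theory Num.Theory.
Import numFieldNormedType.Exports.

Local Open Scope classical_set_scope.
Local Open Scope ring_scope.

(* [lcoef x n] is the coefficient of Y^n. *)
Record laurent (F : fieldType) := Laurent {
  lcoef :> int -> F;
  lcoef_bounded : exists N : int, forall n, N < n -> lcoef n = 0 }.

Section LaurentField.
Variable F : fieldType.
Implicit Types x y z : laurent F.

HB.instance Definition _ := gen_eqMixin (laurent F).
HB.instance Definition _ := gen_choiceMixin (laurent F).

Lemma laurentP x y : (forall n, x n = y n) -> x = y.
Proof.
case: x y => [x xb] [y yb] /= /funext xy; move: xy xb yb => -> xb yb.
by congr Laurent; exact: Prop_irrelevance.
Qed.

Definition lzero : laurent F.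
Proof. by exists (fun=> 0); exists 0. Defined.

Definition lopp x : laurent F.
Proof.
exists (fun n => - x n); have [N xN] := lcoef_bounded x.
by exists N => n /xN ->; rewrite oppr0.
Defined.

Definition ladd x y : laurent F.
Proof.
exists (fun n => x n + y n).
have [N xN] := lcoef_bounded x; have [M yM] := lcoef_bounded y.
exists (Num.max N M) => n; rewrite gt_max => /andP[/xN -> /yM ->].
by rewrite addr0.
Defined.

Definition lmonom (c : F) (k : int) : laurent F.
Proof.
exists (fun n => if n == k then c else 0).
by exists k => n kn; case: eqP => // nk; rewrite nk ltxx in kn.
Defined.

(* Sums over [set: int] denote sums over the (finite) support. *)
Definition lmul x y : laurent F.
Proof.
exists (fun n => \sum_(i \in [set: int]) x i * y (n - i)).
have [N xN] := lcoef_bounded x; have [M yM] := lcoef_bounded y.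
exists (N + M) => n NMn; rewrite fsbig1// => i _.
have [/xN ->|iN] := ltP N i; first by rewrite mul0r.
by rewrite yM ?mulr0//; lia.
Defined.

Local Definition int_itv (a b : int) : set int := [set i | a <= i <= b].

Local Lemma itv_fin a b : finite_set (int_itv a b).
Proof.
apply: (@sub_finite_set _ _ ((fun k : nat => a + k%:Z) @` `I_(`|b - a|.+1)%N)).
  move=> i /andP[? ?]; exists `|i - a|%N; rewrite /=; lia.
exact/finite_image/finite_II.
Qed.

Local Lemma fsum_itv a b (f : int -> F) : (forall i, f i != 0 -> a <= i <= b) ->
  \sum_(i \in [set: int]) f i = \sum_(i \in int_itv a b) f i.
Proof.
move=> fab; apply/esym/fsbig_widen => // i [_ /= iab].
by apply/eqP/negPn/negP => /fab.
Qed.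

Local Lemma fnz (f : int -> F) : \sum_(i \in [set: int]) f i != 0 ->
  exists i, f i != 0.
Proof.
apply: contra_neqP => /forallNP f0; apply: fsbig1 => i _.
by have /negP/negPn/eqP := f0 i.
Qed.

Local Lemma nz x N i : (forall n, N < n -> x n = 0) -> x i != 0 -> i <= N.
Proof. by move=> xN; apply: contraNT; rewrite -ltNge => /xN ->. Qed.

Local Lemma laddA : associative ladd.
Proof. by move=> x y z; apply: laurentP => n /=; rewrite addrA. Qed.
Local Lemma laddC : commutative ladd.
Proof. by move=> x y; apply: laurentP => n /=; rewrite addrC. Qed.
Local Lemma ladd0 : left_id lzero ladd.
Proof. by move=> x; apply: laurentP => n /=; rewrite add0r. Qed.
Local Lemma laddN : left_inverse lzero lopp ladd.
Proof. by move=> x; apply: laurentP => n /=; rewrite addNr. Qed.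

HB.instance Definition _ :=
  GRing.isZmodule.Build (laurent F) laddA laddC ladd0 laddN.

Local Lemma lmulC : commutative lmul.
Proof.
move=> x y; apply: laurentP => n /=.
rewrite (reindex_fsbigT (fun i : int => n - i)); last first.
  by exists (fun i => n - i) => i; lia.
by apply: eq_fsbigr => i _; rewrite mulrC; congr (y _ * _); lia.
Qed.

Local Lemma lmulA : associative lmul.
Proof.
move=> x y z; apply: laurentP => n /=; apply/esym.
have [X xX] := lcoef_bounded x; have [Y yY] := lcoef_bounded y.
have [Z zZ] := lcoef_bounded z.
under eq_fsbigr do rewrite mulr_fsuml.
have H i k : x i * y (k - i) * z (n - k) != 0 ->
    (n - Z <= k <= X + Y) && (n - Z - Y <= i <= X).
  by rewrite !mulf_eq0 !negb_or => /andP[/andP[/(nz xX) ? /(nz yY) ?]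
    /(nz zZ) ?]; lia.
have -> : \sum_(k \in [set: int]) \sum_(i \in [set: int])
    x i * y (k - i) * z (n - k) =
  \sum_(k \in int_itv (n - Z) (X + Y)) \sum_(i \in int_itv (n - Z - Y) X)
    x i * y (k - i) * z (n - k).
  rewrite (@fsum_itv (n - Z) (X + Y)).
    by apply: eq_fsbigr => k _; apply: fsum_itv => i /H /andP[].
  by move=> k /fnz[i /H /andP[]].
rewrite exchange_fsbig; [|exact: itv_fin|exact: itv_fin].
have -> : \sum_(i \in [set: int])
    x i * (\sum_(j \in [set: int]) y j * z (n - i - j)) =
  \sum_(i \in [set: int]) \sum_(k \in [set: int])
    x i * y (k - i) * z (n - k).
  apply: eq_fsbigr => i _; rewrite (reindex_fsbigT (fun k : int => k - i)).
    rewrite mulr_fsumr; apply: eq_fsbigr => k _; rewrite mulrA.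
    by congr (_ * z _); lia.
  by exists (fun k => k + i) => k; lia.
rewrite [RHS](@fsum_itv (n - Z - Y) X).
  by apply/esym/eq_fsbigr => i _; apply: fsum_itv => k /H /andP[].
by move=> i /fnz[k /H /andP[]].
Qed.

Local Lemma lmul1 : left_id (lmonom 1 0) lmul.
Proof.
move=> x; apply: laurentP => n /=.
rewrite -(fsbig_widen [set 0%:Z])//.
  by rewrite fsbig_set1/= mul1r; congr (x _); lia.
by move=> i [_ /= /eqP/negPf ->]; rewrite mul0r.
Qed.

Local Lemma lmulDl : left_distributive lmul ladd.
Proof.
move=> x y z; apply: laurentP => n /=.
have [X xX] := lcoef_bounded x; have [Y yY] := lcoef_bounded y.
have [Z zZ] := lcoef_bounded z.
pose b := Num.max X Y.
have Hx i : x i * z (n - i) != 0 -> n - Z <= i <= b.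
  by rewrite mulf_eq0 negb_or => /andP[/(nz xX) ? /(nz zZ) ?]; lia.
have Hy i : y i * z (n - i) != 0 -> n - Z <= i <= b.
  by rewrite mulf_eq0 negb_or => /andP[/(nz yY) ? /(nz zZ) ?]; lia.
rewrite (fsum_itv Hx) (fsum_itv Hy) -fsbig_split; last exact: itv_fin.
rewrite (@fsum_itv (n - Z) b).
  by apply: eq_fsbigr => i _ /=; rewrite mulrDl.
move=> i; rewrite mulrDl; apply: contra_neqT => H.
have /eqP -> : x i * z (n - i) == 0 by apply: contraNT H; exact: Hx.
have /eqP -> : y i * z (n - i) == 0 by apply: contraNT H; exact: Hy.
by rewrite addr0.
Qed.

Local Lemma lone_neq0 : lmonom 1 0 != lzero.
Proof.
by apply/eqP => /(congr1 (fun u : laurent F => u 0))/= /eqP; rewrite oner_eq0.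
Qed.

HB.instance Definition _ := GRing.Zmodule_isComNzRing.Build (laurent F)
  lmulA lmulC lmul1 lmulDl lone_neq0.

Lemma lcoefM x y n : (x * y) n = \sum_(i \in [set: int]) x i * y (n - i).
Proof. by []. Qed.

Local Lemma lead x : x != 0 -> exists N : int, x N != 0 /\ forall n, N < n -> x n = 0.
Proof.
move=> x0; have [M xM] := lcoef_bounded x.
have [m xm] : exists m : nat, x (M - m%:Z) != 0.
  apply: contrapT => /forallNP H; move/eqP: x0; apply; apply: laurentP => n.
  have [/xM //|nM] := ltP M n.
  have /negP/negPn/eqP := H `|M - n|%N.
  by rewrite (_ : M - _ = n)//; lia.
have ex : exists m : nat, x (M - m%:Z) != 0 by exists m.
case: (ex_minnP ex) => k xk kmin; exists (M - k%:Z); split=> // n kn.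
have [/xM //|nM] := ltP M n.
apply/eqP/negPn/negP => xn.
have := kmin `|M - n|%N; rewrite (_ : M - (`|M - n|%N)%:Z = n); last by lia.
by move=> /(_ xn); lia.
Qed.

Local Lemma inv_seq (a : nat -> F) : exists b : nat -> F,
  a 0%N != 0 -> forall k, \sum_(j < k.+1) a j * b (k - j)%N = (k == 0%N)%:R.
Proof.
pose step (s : seq F) :=
  rcons s ((a 0%N)^-1 * ((size s == 0%N)%:R -
    \sum_(j < size s) a j.+1 * nth 0 s (size s - j.+1)%N)).
pose bs k := iter k step [::].
have sbs k : size (bs k) = k by elim: k => //= k IH; rewrite size_rcons IH.
have nbs k m : (k < m)%N -> nth 0 (bs m) k = nth 0 (bs k.+1) k.
  elim: m => // m IH; rewrite ltnS leq_eqVlt => /predU1P[-> //|km].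
  by rewrite -IH// [bs m.+1]/= /step nth_rcons sbs km.
exists (fun k => nth 0 (bs k.+1) k) => a0 k.
rewrite big_ord_recl/= subn0 {1}/step nth_rcons sbs ltnn eqxx mulrA.
rewrite divff// mul1r; set S := \sum_(i < k) _ * nth _ _ _.
rewrite (_ : \sum_(i < k) _ = S) ?subrK//.
apply: eq_bigr => j _; congr (_ * _).
rewrite /bump/= add1n.
by rewrite [RHS]nbs//; have := ltn_ord j; lia.
Qed.

Local Lemma lhas_inv x : x != 0 -> exists y, y * x = 1.
Proof.
move=> /lead[N [xN0 xN]].
have [b] := inv_seq (fun k => x (N - k%:Z)).
rewrite subr0 => /(_ xN0) bP.
have yP : exists M : int, forall n, M < n ->
    (fun i : int => if i <= - N then b `|- N - i|%N else 0) n = 0.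
  by exists (- N) => n Nn /=; rewrite leNgt Nn.
exists (Laurent yP); rewrite mulrC; apply: laurentP => n.
rewrite lcoefM/=.
have [n0|n0] := ltP 0 n.
  rewrite fsbig1; first by case: eqP n0 => // ->; rewrite ltxx.
  move=> i _; have [/xN ->|iN] := ltP N i; first by rewrite mul0r.
  by case: ifP => [|_]; [lia|rewrite mulr0].
pose k := `|n|%N; have nk : n = - k%:Z by rewrite /k; lia.
rewrite (_ : (if _ then _ else _) = (k == 0%N)%:R :> F); last first.
  by rewrite nk oppr_eq0; case: k {nk}.
rewrite -bP (fsbig_ord _ k.+1 (fun j => x (N - j%:Z) * b (k - j)%N)).
rewrite -(fsbig_widen ((fun j : nat => N - j%:Z) @` `I_k.+1))//.
  rewrite fsbig_image; last by move=> i j _ _ /=; lia.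
  apply: eq_fsbigr => j; rewrite inE /= => jk.
  by rewrite ifT; [congr (_ * b _)|]; lia.
move=> i [_ /= Hi].
have [/xN ->|iN] := ltP N i; first by rewrite mul0r.
case: ifP => [ni|_]; last by rewrite mulr0.
by exfalso; apply: Hi; exists `|N - i|%N => /=; lia.
Qed.

Definition linv x : laurent F :=
  if pselect (x != 0) is left x0 then projT1 (cid (lhas_inv x0)) else 0.

Local Lemma linvP x : x != 0 -> linv x * x = 1.
Proof. by rewrite /linv; case: pselect => // x0 _; case: cid. Qed.

Local Lemma linv0 : linv 0 = 0.
Proof.
by rewrite /linv; case: pselect => // x0; exfalso; move: x0; rewrite eqxx.
Qed.

HB.instance Definition _ := GRing.ComNzRing_isField.Build (laurent F)
  linvP linv0.

(* The Y^{-1}-adic (valuation) topology: a basis of neighbourhoods of [x] is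
   given by the [y] with the same coefficients as [x] in degrees >= n. *)
Definition laurent_open (U : set (laurent F)) :=
  forall x, U x -> exists n : int,
    forall y, (forall k, n <= k -> y k = x k) -> U y.

Local Lemma laurent_openT : laurent_open setT.
Proof. by move=> x _; exists 0. Qed.

Local Lemma laurent_openI : setI_closed laurent_open.
Proof.
move=> U V oU oV x [/oU[n nU] /oV[m mV]]; exists (Num.min n m) => y yx.
by split; [apply: nU|apply: mV] => k nk; apply: yx; rewrite ge_min nk ?orbT.
Qed.

Local Lemma laurent_open_bigU (I : Type) (f : I -> set (laurent F)) :
  (forall i, laurent_open (f i)) -> laurent_open (\bigcup_i f i).
Proof.
by move=> of_ x [i _ /of_[n nU]]; exists n => y /nU fy; exists i.
Qed.

HB.instance Definition _ := isOpenTopological.Build (laurent F)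
  laurent_openT laurent_openI laurent_open_bigU.

Definition laurent_poly (p : {poly F}) : laurent F.
Proof.
exists (fun n => if n is Posz k then p`_k else 0).
by exists (size p)%:Z => -[k|k] //; rewrite ltz_nat => pk; rewrite nth_default// ltnW.
Defined.

End LaurentField.

Section Space.
Variable F : finFieldType.
Local Notation K := (laurent F).

Definition is_lattice (L : set 'cV[K]_2) :=
  exists u v : 'cV[K]_2,
    [/\ L = [set laurent_poly p.1 *: u + laurent_poly p.2 *: v
            | p in [set: {poly F} * {poly F}]],
        forall p q : {poly F},
          laurent_poly p *: u + laurent_poly q *: v = 0 -> p = 0 /\ q = 0
      & forall w, exists a b : K, w = a *: u + b *: v].

Definition homothety_class (L : set 'cV[K]_2) : set (set 'cV[K]_2) :=
  [set (fun w => a *: w) @` L | a in [set a : K | a != 0]].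

(* PGL_2(K) / PGL_2(F[Y]), seen as the set of homothety classes of lattices. *)
Record hspace := HSpace {
  lattices : set (set 'cV[K]_2);
  latticesP : exists2 L, is_lattice L & lattices = homothety_class L }.

HB.instance Definition _ := gen_eqMixin hspace.
HB.instance Definition _ := gen_choiceMixin hspace.

Definition GL2 : set 'M[K]_2 := [set g | g \in unitmx].

Definition std_lattice : set 'cV[K]_2 :=
  [set map_mx (@laurent_poly F) r | r in [set: 'cV[{poly F}]_2]].

Lemma laurent_poly0 : laurent_poly 0 = 0 :> K.
Proof. by apply: laurentP => -[k|k] //=; rewrite coef0. Qed.

Lemma laurent_poly_inj : injective (@laurent_poly F).
Proof.
move=> p q /(congr1 (@lcoef F)) pq; apply/polyP => k.
exact: (congr1 (fun f => f k%:Z) pq).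
Qed.

Lemma std_latticeP : is_lattice std_lattice.
Proof.
have e2 (u : 'cV[K]_2) :
    u = u 0 0 *: delta_mx 0 0 + u 1 0 *: delta_mx 1 0.
  apply/matrixP => i j; rewrite (ord1 j) !mxE/=.
  have [->|->] : i = 0 \/ i = 1.
  - by case: i => -[|[|//]] i2; [left|right]; exact: val_inj.
  - by rewrite /= mulr1 mulr0 addr0.
  - by rewrite /= mulr1 mulr0 add0r.
exists (delta_mx 0 0), (delta_mx 1 0); split.
- apply/seteqP; split=> [_ [r _ <-]|_ [[p q] _ <-]].
    exists (r 0 0, r 1 0) => //=; rewrite [RHS]e2.
    by congr (_ *: _ + _ *: _); rewrite mxE.
  exists (\col_i if i == 0 then p else q) => //=; rewrite [LHS]e2.
  by congr (_ *: _ + _ *: _); rewrite !mxE.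
- move=> p q /matrixP pq.
  have := pq 0 0; have := pq 1 0.
  rewrite !mxE !eqxx/= !mulr0 !mulr1 add0r addr0 -laurent_poly0.
  by move=> /laurent_poly_inj -> /laurent_poly_inj ->.
- by move=> w; exists (w 0 0), (w 1 0).
Qed.

Lemma is_lattice_mul (g : GL2) L :
  is_lattice L -> is_lattice ((fun w => \val g *m w) @` L).
Proof.
have gU : \val g \in unitmx by exact: (set_mem (valP g)).
move=> [u [v [-> uvf uvs]]]; exists (\val g *m u), (\val g *m v); split.
- apply/seteqP; split=> [_ [_ [p _ <-] <-]|_ [p _ <-]].
    by exists p; rewrite // mulmxDr -!scalemxAr.
  exists (laurent_poly p.1 *: u + laurent_poly p.2 *: v); first by exists p.
  by rewrite mulmxDr -!scalemxAr.
- move=> p q; rewrite !scalemxAr -mulmxDr => /(congr1 (mulmx (invmx (\val g)))).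
  by rewrite mulKmx// mulmx0 => /uvf.
- move=> w; have [a [b wE]] := uvs (invmx (\val g) *m w); exists a, b.
  by rewrite !scalemxAr -mulmxDr -wE mulKVmx.
Qed.

Lemma actP (g : GL2) (x : hspace) :
  exists2 L, is_lattice L &
    [set (fun w => \val g *m w) @` L | L in lattices x] = homothety_class L.
Proof.
have [L lL ->] := latticesP x.
exists ((fun w => \val g *m w) @` L); first exact: is_lattice_mul.
have H a : (fun w => \val g *m w) @` ((fun w => a *: w) @` L) =
    (fun w => a *: w) @` ((fun w => \val g *m w) @` L).
  by rewrite !image_comp; apply: eq_imagel => w _ /=; rewrite scalemxAr.
apply/seteqP; split=> [_ [_ [a a0 <-] <-]|_ [a a0 <-]].
  by exists a => //; rewrite H.
by exists ((fun w => a *: w) @` L); [exists a|rewrite H].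
Qed.

(* The action of GL_2(K) on classes of lattices; the scalar matrices act
   trivially, so that it is the action of PGL_2(K). *)
Definition act (g : GL2) (x : hspace) : hspace := HSpace (actP g x).

Definition base_point : hspace :=
  @HSpace (homothety_class std_lattice)
    (ex_intro2 _ _ _ std_latticeP erefl).

HB.instance Definition _ := isPointed.Build hspace base_point.

(* The quotient topology for g |-> [g (F[Y] x F[Y])], where GL_2(K) has the
   topology induced by that of 2 x 2 matrices. *)
Definition hspace_open (U : set hspace) :=
  open ((fun g : GL2 => act g base_point) @^-1` U).

Local Lemma hspace_openT : hspace_open setT.
Proof. by rewrite /hspace_open preimage_setT; exact: openT. Qed.

Local Lemma hspace_openI : setI_closed hspace_open.
Proof. by move=> U V oU oV; exact: openI. Qed.

Local Lemma hspace_open_bigU (I : Type) (f : I -> set hspace) :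
  (forall i, hspace_open (f i)) -> hspace_open (\bigcup_i f i).
Proof. by move=> of_; apply: bigcup_open => i _; exact: of_. Qed.

HB.instance Definition _ := isOpenTopological.Build hspace
  hspace_openT hspace_openI hspace_open_bigU.

Definition borel := g_sigma_algebraType (@open hspace).

Definition diag_orbit (x : hspace) : set hspace :=
  [set act a x | a in [set a : GL2 | is_diag_mx (\val a)]].

Definition diag_periodic (x : hspace) := compact (diag_orbit x).

Inductive walk (e : hspace -> hspace -> Prop) : nat -> hspace -> hspace -> Prop :=
  | walk0 x : walk e 0 x x
  | walkS k x y z : e x y -> walk e k y z -> walk e k.+1 x z.

(* L / L' is isomorphic to F[Y] / nu F[Y] as an F[Y]-module: the isomorphism is
   given by a map [f] to representatives in F[Y], which is linear modulo nu and
   surjective modulo nu on [L], and for which [L'] is the kernel modulo nu. *)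
Definition quotient_iso (nu : {poly F}) (L L' : set 'cV[K]_2) :=
  exists f : 'cV[K]_2 -> {poly F},
    [/\ forall (p : {poly F}) u v, L u -> L v ->
          (nu %| f (laurent_poly p *: u + v)%R - (p * f u + f v)),
        forall r : {poly F}, exists2 u, L u & (nu %| f u - r)
      & forall u, L u -> (nu %| f u) <-> L' u].

Definition hecke_step (nu : {poly F}) (x y : hspace) :=
  exists L L', [/\ lattices x L, lattices y L', L' `<=` L
    & quotient_iso nu L L'].

Definition hecke_edge (nu : {poly F}) (x y : hspace) :=
  hecke_step nu x y \/ hecke_step nu y x.

Definition hecke_tree (nu : {poly F}) (x0 : hspace) : set hspace :=
  [set y | exists k, walk (hecke_edge nu) k x0 y].

(* For i <= j, the last condition says that [r i] and [r j] are at distance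
   at least j - i in the graph. *)
Definition geodesic_ray (nu : {poly F}) (r : nat -> hspace) :=
  (forall n, hecke_edge nu (r n) (r n.+1)) /\
  (forall i j k, walk (hecke_edge nu) k (r i) (r j) -> (j - i <= k)%N).

(* In a tree, two geodesic rays have the same end if and only if they
   eventually coincide, up to a shift. *)
Definition end_of (nu : {poly F}) (r : nat -> hspace) : set (nat -> hspace) :=
  [set s | geodesic_ray nu s /\
    exists i j, forall n, r (i + n)%N = s (j + n)%N].

Definition hecke_ends (nu : {poly F}) (x0 : hspace) :
    set (set (nat -> hspace)) :=
  [set end_of nu r
  | r in [set r | geodesic_ray nu r /\ forall n, hecke_tree nu x0 (r n)]].

Definition ray_from_to (x0 : hspace) (xi : set (nat -> hspace))
    (r : nat -> hspace) :=
  xi r /\ r 0%N = x0.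

Variable R : realType.

Definition orbit_measure (x : hspace) (m : probability borel R) :=
  m (diag_orbit x) = 1%E /\
  forall a : GL2, is_diag_mx (\val a) ->
    forall E : set borel, measurable E -> m (act a @^-1` E) = m E.

Definition homogeneous_measure (m : probability borel R) :=
  forall (g : GL2) (E : set borel), measurable E -> m (act g @^-1` E) = m E.

Definition compactly_supported (f : hspace -> R) :=
  continuous f /\ compact (closure [set x | f x != 0]).

(* Basic weak-star neighbourhoods of [theta] are given by finitely many test
   functions and a tolerance. *)
Definition weak_star_accumulation (m : nat -> {measure set borel -> \bar R})
    (theta : {measure set borel -> \bar R}) :=
  (forall C : set hspace, compact C -> (theta C < +oo)%E) /\
  forall (k : nat) (f : 'I_k -> hspace -> R),
    (forall i, compactly_supported (f i)) ->
    forall (e : R) (N : nat), 0 < e ->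
    exists2 n, (N <= n)%N &
      forall i, `| \int[m n]_x f i x - \int[theta]_x f i x | < e.

Definition Theta (mu : hspace -> probability borel R) (x0 : hspace)
    (xi : set (nat -> hspace)) : set {measure set borel -> \bar R} :=
  [set theta | exists2 r, ray_from_to x0 xi r &
    weak_star_accumulation (fun n => mu (r n)) theta].

End Space.

(* Main.v *)
From HB Require Import structures.
Require Import Defs.
From mathcomp Require Import all_boot all_order all_algebra.
From mathcomp Require Import all_classical all_reals all_analysis.
From mathcomp Require Import measurable_realfun.
From mathcomp Require finfield.
From mathcomp Require Import zify ring lra.

Set Implicit Arguments.
Unset Strict Implicit.
Unset Printing Implicit Defensive.

Import Order.TTheory GRing.Theory Num.Theory.
Import numFieldNormedType.Exports.

Local Open Scope classical_set_scope.
Local Open Scope ring_scope.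

(** Let [K] be the field of Laurent series. A diagonal orbit is an orbit of [K^*], acting
    by the matrices [diag(a, 1)]. A compact orbit has a period [Q]: some [Y^Q u], with
    [u] a unit of the valuation ring, fixes its points ([period_ex]). The measure of an
    orbit is then the average over the units and over [Q] consecutive powers of [Y]
    ([orbit_average]), and if a point of an orbit of period [Q] agrees with a point of
    the orbit of [x] to precision [s + T], the two orbits stay [s]-close for a time [T],
    so that on sets that only see precision [s] the measure of the first orbit is at
    least about [T / Q] times that of the orbit of [x] ([shadow_measure]).

    The ray to be found must therefore pass through points that shadow the orbit of [x]
    during a time comparable with their own period. Two estimates make this possible.
    Firstly, periods grow only linearly along rays, because raising to the power [p^e] is
    additive: if a period of [x0] acts as [1 + nu V] in a basis, its [p^e]-th power acts
    as [1 + nu^(p^e) V'], and preserves all the lattices at distance at most [p^e]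
    ([vertex_period]). Secondly, precision is gained linearly: from any vertex, [6 j] more
    steps away from [x0] reach a point that agrees with the orbit of [x] to precision [j],
    up to a constant ([hecke_approx]). So, from any vertex of a ray under construction,
    one can go on for a distance that dwarfs all the previous choices and reach a vertex
    at distance about [q = p^e], of period at most [P0 C q], that shadows [x] for a time at
    least [q / 12] ([vertex_shadow]). The proportion [c' = 1 / (12 P0 C)] depends only on
    [x0] and [nu]. Doing this infinitely often, with better and better precision, defines a
    ray ([prolongation]).

    An accumulation point of the measures of these vertices dominates [c'] times the
    measure of the orbit of [x] ([weak_limit]). It is obtained from the limits of the
    masses of the compact open sets, along an ultrafilter, by Caratheodory's extension;
    every test function is uniformly close to a combination of indicators of compact open
    sets ([step_approximation]).

    Finally, the orbit of [x] has positive measure for this limit, but is null for the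
    homogeneous measure: its translates by unipotent matrices are pairwise disjoint, since
    an element of the diagonal group that contracts the unipotent subgroup fixes all the
    points of the orbit ([unipotent_transverse], [homogeneous_diag_orbit]). *)

(** * Laurent series *)

Section LaurentBounds.
Variable F : fieldType.
Local Notation K := (laurent F).
Implicit Types (x y : K) (d e i k n : int) (p q : {poly F}).

(** Degree at most [d]: the closed balls about [0] of the valuation. *)
Definition bnd d x := forall k, d < k -> x k = 0.

Lemma lcoefD x y n : (x + y) n = x n + y n. Proof. by []. Qed.
Lemma lcoefN x n : (- x) n = - x n. Proof. by []. Qed.
Lemma lcoefB x y n : (x - y) n = x n - y n. Proof. by []. Qed.
Lemma bnd0 d : bnd d 0. Proof. by []. Qed.

Lemma bndW d e x : d <= e -> bnd d x -> bnd e x.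
Proof. by move=> de xd k ek; apply: xd; exact: le_lt_trans ek. Qed.

Lemma bndD d x y : bnd d x -> bnd d y -> bnd d (x + y).
Proof. by move=> xd yd k dk; rewrite lcoefD xd// yd// addr0. Qed.

Lemma bndN d x : bnd d x -> bnd d (- x).
Proof. by move=> xd k dk; rewrite lcoefN xd// oppr0. Qed.

Lemma bndB d x y : bnd d x -> bnd d y -> bnd d (x - y).
Proof. by move=> xd /bndN; exact: bndD. Qed.

Lemma bndM d e x y : bnd d x -> bnd e y -> bnd (d + e) (x * y).
Proof.
move=> xd ye k dek; rewrite lcoefM fsbig1// => i _.
have [/xd ->|id] := ltP d i; first by rewrite mul0r.
by rewrite ye ?mulr0//; lia.
Qed.

Lemma bndMW d e f x y : d + e <= f -> bnd d x -> bnd e y -> bnd f (x * y).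
Proof. by move=> def xd ye; apply: bndW def _; exact: bndM. Qed.

Lemma lcoefM_lead d e x y :
  bnd d x -> bnd e y -> (x * y) (d + e) = x d * y e.
Proof.
move=> xd ye; rewrite lcoefM -(fsbig_widen [set d])//.
  by rewrite fsbig_set1/=; congr (_ * y _); lia.
move=> i [_ /= /eqP id].
have [/xd ->|di] := ltP d i; first by rewrite mul0r.
by rewrite ye ?mulr0//; lia.
Qed.

Lemma bnd_ex x : exists d, bnd d x.
Proof. by have [d xd] := lcoef_bounded x; exists d. Qed.

Lemma bnd_all x : (forall d, bnd d x) -> x = 0.
Proof. by move=> xb; apply: laurentP => n; apply: (xb (n - 1)); lia. Qed.

Lemma degree_ex x : x != 0 -> exists d, bnd d x /\ x d != 0.
Proof. by move=> /Defs.lead[d [xd xb]]; exists d. Qed.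

Lemma lmonomM c k x n : (lmonom c k * x) n = c * x (n - k).
Proof.
rewrite lcoefM -(fsbig_widen [set k])//=; first by rewrite fsbig_set1/= eqxx.
by move=> i [_ /= /eqP/negPf ->]; rewrite mul0r.
Qed.

Definition Ymon k : K := lmonom 1 k.

Lemma Ymon0 : Ymon 0 = 1. Proof. by []. Qed.

Lemma YmonM k x n : (Ymon k * x) n = x (n - k).
Proof. by rewrite lmonomM mul1r. Qed.

Lemma YmonD i k : Ymon (i + k) = Ymon i * Ymon k.
Proof.
apply: laurentP => n; rewrite YmonM /=; congr (if _ then _ else _).
by apply/eqP/eqP; lia.
Qed.

Lemma Ymon_bnd k : bnd k (Ymon k).
Proof. by move=> n kn /=; rewrite gt_eqF. Qed.

Lemma Ymon_neq0 k : Ymon k != 0.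
Proof.
by apply/eqP => /(congr1 (fun u : K => u k))/=; rewrite eqxx => /eqP; rewrite oner_eq0.
Qed.

Lemma YmonV k : (Ymon k)^-1 = Ymon (- k).
Proof.
by apply: (mulfI (Ymon_neq0 k)); rewrite divff ?Ymon_neq0// -YmonD subrr.
Qed.

Lemma bnd_inv d x : bnd d x -> x d != 0 -> bnd (- d) x^-1 /\ x^-1 (- d) != 0.
Proof.
move=> xd x0; have xn0 : x != 0 by apply: contraNneq x0 => ->.
have [e [xe e0]] : exists e, bnd e x^-1 /\ x^-1 e != 0.
  by apply: degree_ex; rewrite invr_eq0.
have := lcoefM_lead xd xe; rewrite divff//= => H.
suff -> : - d = e by [].
have [de|/eqP de] := eqVneq (d + e) 0; first by lia.
move: H => /=; rewrite ifN; last exact/eqP.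
by move=> /esym/eqP; rewrite mulf_eq0 (negPf x0) (negPf e0).
Qed.

(** The units of the valuation ring of [K]. *)
Definition lunit x := bnd 0 x /\ x 0 != 0.

Lemma lunit1 : lunit 1.
Proof. by split; [exact: Ymon_bnd | rewrite /= oner_eq0]. Qed.

Lemma lunit_neq0 x : lunit x -> x != 0.
Proof. by move=> [_]; apply: contraNneq => ->. Qed.

Lemma lunitV x : lunit x -> lunit x^-1.
Proof. by move=> [xb x0]; have := bnd_inv xb x0; rewrite oppr0. Qed.

Lemma lunitM x y : lunit x -> lunit y -> lunit (x * y).
Proof.
move=> [xb x0] [yb y0]; split; first by rewrite -(addr0 0); exact: bndM.
by rewrite -(addr0 0) lcoefM_lead// mulf_eq0 negb_or x0.
Qed.

Lemma lunit_near1 x d : d < 0 -> bnd d (x - 1) -> lunit x.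
Proof.
move=> d0 xb; split=> [k k0|].
  by have := xb k (lt_trans d0 k0); rewrite lcoefB /= gt_eqF// subr0.
by have /eqP := xb 0 d0; rewrite lcoefB /= subr_eq0 => /eqP ->; rewrite oner_eq0.
Qed.

Lemma degreeP x : x != 0 -> exists2 d, lunit (Ymon (- d) * x) & x = Ymon d * (Ymon (- d) * x).
Proof.
move=> /degree_ex[d [xd x0]]; exists d.
  split; first by apply: (bndMW _ (@Ymon_bnd _) xd); lia.
  by rewrite YmonM opprK add0r.
by rewrite mulrA -YmonD subrr mul1r.
Qed.

Lemma lpolyD : {morph @laurent_poly F : p q / p + q}.
Proof. by move=> p q; apply: laurentP => -[k|k] /=; rewrite ?coefD ?addr0. Qed.

Lemma lpolyN : {morph @laurent_poly F : p / - p}.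
Proof. by move=> p; apply: laurentP => -[k|k] /=; rewrite ?coefN ?oppr0. Qed.

Lemma lpolyC (c : F) : laurent_poly c%:P = lmonom c 0.
Proof. by apply: laurentP => -[[|k]|k] //=; rewrite coefC. Qed.

Lemma lpolyZ (c : F) p : laurent_poly (c *: p) = lmonom c 0 * laurent_poly p.
Proof.
by apply: laurentP => n; rewrite lmonomM subr0; case: n => k /=; rewrite ?coefZ ?mulr0.
Qed.

Lemma lpolyMX p : laurent_poly (p * 'X) = laurent_poly p * Ymon 1.
Proof.
apply: laurentP => n; rewrite [in RHS]mulrC YmonM.
case: n => [[|k]|k].
- by rewrite /= coefMX.
- by rewrite (_ : k.+1%:Z - 1 = k%:Z) /= ?coefMX//; lia.
- by rewrite (_ : Negz k - 1 = Negz k.+1) //; lia.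
Qed.

Lemma lpolyM : {morph @laurent_poly F : p q / p * q}.
Proof.
move=> p q; elim/poly_ind: p => [|p c IH].
  by rewrite mul0r (_ : laurent_poly 0 = 0) ?mul0r// -(subrr 0) lpolyD lpolyN subrr.
rewrite mulrDl mulrAC mul_polyC !lpolyD !lpolyMX lpolyZ IH lpolyC mulrDl.
by rewrite mulrAC.
Qed.

Lemma lpoly1 : laurent_poly 1 = 1 :> K.
Proof. exact: lpolyC. Qed.

Fact lpoly_is_zmod_morphism : zmod_morphism (@laurent_poly F).
Proof. by move=> p q; rewrite lpolyD lpolyN. Qed.

Fact lpoly_is_monoid_morphism : monoid_morphism (@laurent_poly F).
Proof. by split; [exact: lpoly1 | exact: lpolyM]. Qed.

HB.instance Definition _ := GRing.isZmodMorphism.Build {poly F} K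
  (@laurent_poly F) lpoly_is_zmod_morphism.
HB.instance Definition _ := GRing.isMonoidMorphism.Build {poly F} K
  (@laurent_poly F) lpoly_is_monoid_morphism.

Lemma lpoly_small p : bnd (-1) (laurent_poly p) -> p = 0.
Proof.
by move=> pb; apply/polyP => k; rewrite coef0; exact: (pb k%:Z).
Qed.

Lemma lpoly_inj p q : laurent_poly p = laurent_poly q -> p = q.
Proof.
move=> pq; apply/subr0_eq/lpoly_small.
by rewrite rmorphB /= pq subrr; exact: bnd0.
Qed.

Lemma lpoly_eq0 p : (laurent_poly p == 0) = (p == 0).
Proof.
by apply/eqP/eqP => [|->]; [rewrite -(rmorph0 (@laurent_poly F)); exact: lpoly_inj|rewrite rmorph0].
Qed.

Lemma lpoly_degree p : p != 0 ->
  bnd (size p).-1%:Z (laurent_poly p) /\ laurent_poly p (size p).-1%:Z != 0.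
Proof.
move=> p0; split; last by rewrite /= -lead_coefE lead_coef_eq0.
case=> k // /[!ltz_nat] kp /=; rewrite nth_default//.
by rewrite -(prednK (n := size p)) // size_poly_gt0.
Qed.

Lemma polypart_ex x : exists p, bnd (-1) (x - laurent_poly p).
Proof.
have [d xd] := bnd_ex x; exists (\poly_(k < `|d|.+1) x k%:Z) => -[k|k] // _.
rewrite lcoefB /= coef_poly; case: ltnP => [_|dk]; first by rewrite subrr.
rewrite subr0 xd//; apply: le_lt_trans (_ : `|d|%N%:Z < _); first exact: lez_abs.
by rewrite ltz_nat.
Qed.

Definition polypart x : {poly F} := projT1 (cid (polypart_ex x)).

Lemma polypartP x : bnd (-1) (x - laurent_poly (polypart x)).
Proof. by rewrite /polypart; case: cid. Qed.

Lemma polypartK p : polypart (laurent_poly p) = p.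
Proof.
by apply/esym/subr0_eq/lpoly_small; rewrite rmorphB; exact: polypartP.
Qed.

End LaurentBounds.

(** * Two by two matrices of Laurent series *)

Section Matrices2.
Variable T : comNzRingType.
Implicit Types (a b c d : T) (A B C : 'M[T]_2).

Definition mk2 a b c d : 'M[T]_2 :=
  \matrix_(i, j) if i == 0 then if j == 0 then a else b
                 else if j == 0 then c else d.

Lemma mk2E a b c d : ((mk2 a b c d 0 0 = a) * (mk2 a b c d 0 1 = b) *
  (mk2 a b c d 1 0 = c) * (mk2 a b c d 1 1 = d))%type.
Proof. by rewrite !mxE. Qed.

Lemma ord2P (P : 'I_2 -> Prop) : P 0 -> P 1 -> forall i, P i.
Proof.
move=> P0 P1 i; have [->|->] // : i = 0 \/ i = 1.
by case: i => -[|[|//]] i2; [left|right]; exact: val_inj.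
Qed.

Lemma mx2P A B : A 0 0 = B 0 0 -> A 0 1 = B 0 1 -> A 1 0 = B 1 0 ->
  A 1 1 = B 1 1 -> A = B.
Proof.
move=> *; apply/matrixP; apply: ord2P; apply: ord2P; done.
Qed.

Lemma mk2_eta A : A = mk2 (A 0 0) (A 0 1) (A 1 0) (A 1 1).
Proof. by apply: mx2P; rewrite mk2E. Qed.

Lemma mulmx2E A B i j : (A *m B) i j = A i 0 * B 0 j + A i 1 * B 1 j.
Proof. by rewrite mxE big_ord_recl big_ord1; congr (_ + A i _ * B _ j); exact: val_inj. Qed.

Lemma mulcv2E A (u : 'cV[T]_2) i : (A *m u) i 0 = A i 0 * u 0 0 + A i 1 * u 1 0.
Proof. by rewrite mxE big_ord_recl big_ord1; congr (_ + A i _ * u _ 0); exact: val_inj. Qed.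

Lemma mk2M a b c d a' b' c' d' : mk2 a b c d *m mk2 a' b' c' d' =
  mk2 (a * a' + b * c') (a * b' + b * d') (c * a' + d * c') (c * b' + d * d').
Proof. by apply: mx2P; rewrite mulmx2E !mk2E. Qed.

Lemma mk2_1 : mk2 1 0 0 1 = 1%:M.
Proof. by apply: mx2P; rewrite mk2E !mxE. Qed.

Lemma mk2_scalar a : mk2 a 0 0 a = a%:M.
Proof. by apply: mx2P; rewrite mk2E !mxE. Qed.

Lemma det2 A : \det A = A 0 0 * A 1 1 - A 0 1 * A 1 0.
Proof.
rewrite (expand_det_row _ 0) big_ord_recl big_ord1 /cofactor !det_mx11 !mxE /=.
rewrite expr0 mul1r expr1 mulN1r mulrN.
by congr (_ * A _ _ - A _ _ * A _ _); exact: val_inj.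
Qed.

Lemma mk2_det a b c d : \det (mk2 a b c d) = a * d - b * c.
Proof. by rewrite det2 !mk2E. Qed.

Lemma mk2_adjM a b c d : mk2 a b c d *m mk2 d (- b) (- c) a = (a * d - b * c)%:M.
Proof.
by rewrite mk2M -mk2_scalar; congr mk2; ring.
Qed.

Lemma mulmx3B A B C A' B' C' : A' *m B' *m C' - A *m B *m C =
  (A' - A) *m B' *m C' + A *m (B' - B) *m C' + A *m B *m (C' - C).
Proof.
by rewrite !mulmxBl !mulmxBr !mulmxBl !addrA !subrK.
Qed.

Lemma mulmx3Z a A B C : (a *: A) *m (a *: B) *m (a *: C) = a ^+ 3 *: (A *m B *m C).
Proof.
by rewrite -!scalemxAl -!scalemxAr -!scalemxAl !scalerA !exprS expr0 mulr1 mulrA.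
Qed.

Lemma mk2_diag a d : is_diag_mx (mk2 a 0 0 d).
Proof.
by apply/is_diag_mxP; apply: ord2P; apply: ord2P; rewrite ?mk2E ?eqxx.
Qed.

Lemma diag_mk2 A : is_diag_mx A -> A = mk2 (A 0 0) 0 0 (A 1 1).
Proof.
by move=> /is_diag_mxP dA; apply: mx2P; rewrite mk2E// dA.
Qed.

End Matrices2.

Section Matrices2Unit.
Variable T : comUnitRingType.
Implicit Types (a b c d : T) (A B : 'M[T]_2).

Lemma mk2_unit a b c d : (mk2 a b c d \in unitmx) = (a * d - b * c \is a GRing.unit).
Proof. by rewrite unitmxE mk2_det. Qed.

Lemma mk2_inv a b c d : a * d - b * c \is a GRing.unit ->
  invmx (mk2 a b c d) = (a * d - b * c)^-1 *: mk2 d (- b) (- c) a.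
Proof.
move=> u; have uA : mk2 a b c d \in unitmx by rewrite mk2_unit.
apply: (can_inj (mulKmx uA)); rewrite mulmxV// -scalemxAr mk2_adjM.
by rewrite scale_scalar_mx mulVr.
Qed.
End Matrices2Unit.

Section LaurentMatrices.
Variable F : fieldType.
Local Notation K := (laurent F).
Implicit Types A B C : 'M[K]_2.

(** Locked, because the comparison by conversion of two boolean tests
    [_ \in unitmx] over [K] is expensive. *)
Definition invertible := locked (fun A => A \in unitmx : Prop).

Lemma invertibleP A : invertible A <-> A \in unitmx.
Proof. by rewrite /invertible -lock. Qed.

(** A copy of [invmx] in which the ring of coefficients is [laurent F] itself. *)
Definition minv A : 'M[K]_2 := invmx A.

Lemma invertible_det A : invertible A <-> \det A != 0.
Proof. by rewrite invertibleP (@unitmxE K 2) unitfE. Qed.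

Lemma invertibleM A B : invertible A -> invertible B -> invertible (A *m B).
Proof.
move=> /invertibleP uA /invertibleP uB; apply/invertibleP.
by rewrite (@unitmx_mul K 2) uA.
Qed.

Lemma invertibleV A : invertible A -> invertible (minv A).
Proof. by move=> /invertibleP uA; apply/invertibleP; rewrite /minv (@unitmx_inv K 2). Qed.

Lemma invertible1 : invertible 1%:M.
Proof. by apply/invertibleP; exact: (@unitmx1 K 2). Qed.

Lemma invertible_scalar (c : K) : c != 0 -> invertible c%:M.
Proof. by move=> c0; rewrite invertible_det (@det_scalar K) expf_neq0. Qed.

Lemma invertibleZ (c : K) A : c != 0 -> invertible A -> invertible (c *: A).
Proof.
by move=> c0 iA; rewrite -mul_scalar_mx; apply: invertibleM iA; exact: invertible_scalar.
Qed.

Lemma invertible_right A B : A *m B = 1%:M -> invertible A.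
Proof. by move=> AB; have [uA _] := @mulmx1_unit K 2 A B AB; apply/invertibleP. Qed.

Lemma minvK A : minv (minv A) = A.
Proof. exact: (@invmxK K 2). Qed.

Lemma mulIV A : invertible A -> A *m minv A = 1%:M.
Proof. by move=> /invertibleP uA; exact: (@mulmxV K 2). Qed.

Lemma mulVI A : invertible A -> minv A *m A = 1%:M.
Proof. by move=> /invertibleP uA; exact: (@mulVmx K 2). Qed.

Lemma mulIK n A : invertible A -> cancel (@mulmx _ 2 2 n A) (mulmx (minv A)).
Proof. by move=> /invertibleP uA; exact: (@mulKmx K 2 n). Qed.

Lemma mulVIK n A : invertible A -> cancel (@mulmx _ 2 2 n (minv A)) (mulmx A).
Proof. by move=> /invertibleP uA; exact: (@mulKVmx K 2 n). Qed.

Lemma mulKI A B : invertible A -> B *m A *m minv A = B.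
Proof. by move=> iA; rewrite -mulmxA mulIV// mulmx1. Qed.

Lemma mulKVI A B : invertible A -> B *m minv A *m A = B.
Proof. by move=> iA; rewrite -mulmxA mulVI// mulmx1. Qed.

Lemma KscaleAr m n k (c : K) (A : 'M[K]_(m, n)) (B : 'M[K]_(n, k)) :
  A *m (c *: B) = c *: (A *m B).
Proof. exact/esym/(@scalemxAr K). Qed.

Lemma KscaleAl m n k (c : K) (A : 'M[K]_(m, n)) (B : 'M[K]_(n, k)) :
  (c *: A) *m B = c *: (A *m B).
Proof. exact/esym/(@scalemxAl K). Qed.

Lemma Kmul_scalar_mx m (c : K) (A : 'M[K]_(2, m)) : c%:M *m A = c *: A.
Proof. exact: (@mul_scalar_mx K). Qed.

Lemma Kmul_mx_scalar m (c : K) (A : 'M[K]_(m, 2)) : A *m c%:M = c *: A.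
Proof. exact: (@mul_mx_scalar K). Qed.

Lemma Kscalar1 (c : K) : c%:M = c *: 1%:M :> 'M[K]_2.
Proof. by rewrite -Kmul_scalar_mx mulmx1. Qed.

Lemma KscaleA (c d : K) A : c *: (d *: A) = (c * d) *: A.
Proof. exact: (@scalerA K). Qed.

Lemma Kscale1 A : 1 *: A = A.
Proof. exact: (@scale1r K). Qed.

Lemma Kscale3 (c : K) A B C :
  (c *: A) *m (c *: B) *m (c *: C) = c ^+ 3 *: (A *m B *m C).
Proof. exact: (@mulmx3Z K). Qed.

Lemma Kdet_mul A B : \det (A *m B) = \det A * \det B.
Proof. exact: (@det_mulmx K). Qed.

Lemma invertible_mk2 (a b c d : K) : invertible (mk2 a b c d) <-> a * d - b * c != 0.
Proof. by rewrite invertible_det mk2_det. Qed.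

Lemma inv_mk2 (a b c d : K) : a * d - b * c != 0 ->
  minv (mk2 a b c d) = (a * d - b * c)^-1 *: mk2 d (- b) (- c) a.
Proof. by move=> u; rewrite /minv mk2_inv// unitfE. Qed.

End LaurentMatrices.

Section MatrixBounds.
Variable F : fieldType.
Local Notation K := (laurent F).
Implicit Types (A B : 'M[K]_2) (d e : int) (s : nat).

Definition mbnd d A := forall i j, bnd d (A i j).

Lemma mbndW d e A : d <= e -> mbnd d A -> mbnd e A.
Proof. by move=> de Ad i j; exact: bndW de _. Qed.

Lemma mbndD d A B : mbnd d A -> mbnd d B -> mbnd d (A + B).
Proof. by move=> Ad Bd i j; rewrite mxE; exact: bndD. Qed.

Lemma mbndN d A : mbnd d A -> mbnd d (- A).
Proof. by move=> Ad i j; rewrite mxE; exact: bndN. Qed.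

Lemma mbndB d A B : mbnd d A -> mbnd d B -> mbnd d (A - B).
Proof. by move=> Ad /mbndN; exact: mbndD. Qed.

Lemma mbndM d e A B : mbnd d A -> mbnd e B -> mbnd (d + e) (A *m B).
Proof. by move=> Ad Be i j; rewrite mulmx2E; apply: bndD; exact: bndM. Qed.

Lemma mbndMW d e f A B : d + e <= f -> mbnd d A -> mbnd e B -> mbnd f (A *m B).
Proof. by move=> def Ad Be; apply: mbndW def _; exact: mbndM. Qed.

Lemma mbnd_ex A : exists d : nat, mbnd d A.
Proof.
have [d dP] := choice (fun i : 'I_2 * 'I_2 => bnd_ex (A i.1 i.2)).
exists (\max_i `|d i|)%N => i j; apply: bndW (dP (i, j)).
apply: le_trans (lez_abs _) _; rewrite lez_nat.
exact: (leq_bigmax (F := fun i => `|d i|%N)).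
Qed.

Lemma mbnd1 : mbnd 0 (1%:M : 'M[K]_2).
Proof.
by rewrite -mk2_1; apply: ord2P; apply: ord2P; rewrite mk2E//; exact: (lunit1 F).1.
Qed.

Lemma mk2_mbnd d (a b c e : K) :
  bnd d a -> bnd d b -> bnd d c -> bnd d e -> mbnd d (mk2 a b c e).
Proof. by move=> ? ? ? ?; apply: ord2P; apply: ord2P; rewrite mk2E. Qed.

Lemma mbndZ d e (c : K) A : bnd d c -> mbnd e A -> mbnd (d + e) (c *: A).
Proof. by move=> cd Ae i j; rewrite mxE; exact: bndM. Qed.

(** The congruence subgroups of [GL_2] of the valuation ring; the shift of the
    index makes every one of them consist of invertible matrices. *)
Definition near1 s A := mbnd (- s.+1%:Z) (A - 1%:M).

Lemma near1W s t A : (t <= s)%N -> near1 s A -> near1 t A.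
Proof. by move=> ts; apply: mbndW; lia. Qed.

Lemma near1_1 s : near1 s 1%:M.
Proof. by rewrite /near1 subrr => i j; rewrite mxE; exact: bnd0. Qed.

Lemma near1_int s A : near1 s A -> mbnd 0 A.
Proof.
by move=> As; rewrite -(subrK 1%:M A); apply: mbndD mbnd1; apply: mbndW As; lia.
Qed.

Lemma near1M s A B : near1 s A -> near1 s B -> near1 s (A *m B).
Proof.
move=> As Bs; rewrite /near1.
have -> : A *m B - 1%:M = A *m (B - 1%:M) + (A - 1%:M).
  by rewrite mulmxBr mulmx1 addrA subrK.
apply: (mbndD _ As); apply: mbndMW (near1_int As) Bs; lia.
Qed.

Lemma near1_det s A : near1 s A -> lunit (\det A).
Proof.
move=> As; apply: (@lunit_near1 _ _ (-1)) => //.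
have Ai := near1_int As.
have As' : mbnd (-1) (A - 1%:M) by apply: mbndW As; lia.
have -> : \det A - 1 =
    (A - 1%:M) 0 0 * A 1 1 + (A - 1%:M) 1 1 - (A - 1%:M) 0 1 * A 1 0.
  by rewrite det2 !mxE /= ; ring.
apply: bndB; first apply: bndD; last exact: bndMW (As' _ _) (Ai _ _).
  exact: bndMW (As' _ _) (Ai _ _).
exact: As'.
Qed.

Lemma near1_unit s A : near1 s A -> invertible A.
Proof. by move=> /near1_det /lunit_neq0 ?; apply/invertible_det. Qed.

Lemma mbnd_inv A : lunit (\det A) -> mbnd 0 A -> mbnd 0 (minv A).
Proof.
rewrite (mk2_eta A) mk2_det => u Ai; have un := lunit_neq0 u.
have E := (Ai 0 0, Ai 0 1, Ai 1 0, Ai 1 1); rewrite !mk2E in E.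
case: E => [[[? ?] ?] ?].
rewrite inv_mk2// -[0]addr0; apply: mbndZ; first exact: (lunitV u).1.
by apply: mk2_mbnd => //; exact: bndN.
Qed.

Lemma near1V s A : near1 s A -> near1 s (minv A).
Proof.
move=> As; have uA := near1_unit As; rewrite /near1.
have -> : minv A - 1%:M = - (minv A *m (A - 1%:M)).
  by rewrite mulmxBr mulVI// mulmx1 opprB.
apply: mbndN; apply: mbndMW (mbnd_inv (near1_det As) (near1_int As)) As.
by rewrite add0r.
Qed.

Lemma near1_quot A : invertible A -> exists C : nat, forall s B,
  mbnd (- (s + C)%:Z) (B - A) -> near1 s (B *m minv A).
Proof.
move=> uA; have [c cP] := mbnd_ex (minv A); exists c.+1 => s B BA.
rewrite /near1 -(mulIV uA) -mulmxBl; apply: mbndMW BA cP; lia.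
Qed.

Lemma near1_conj A : invertible A -> exists C : nat, forall s B,
  near1 (s + C) B -> near1 s (A *m B *m minv A).
Proof.
move=> uA; have [c cP] := mbnd_ex (minv A); have [d dP] := mbnd_ex A.
exists (c + d)%N => s B BA.
rewrite /near1 -(mulIV uA) -{3}(mulmx1 A) -mulmxBl -mulmxBr.
apply: mbndMW (mbndM dP BA) cP; lia.
Qed.

End MatrixBounds.

(** * Lattices and their homothety classes *)

Section Classes.
Variable F : finFieldType.
Local Notation K := (laurent F).
Implicit Types (A B : 'M[K]_2) (x y : hspace F).

Definition lmap m n (Z : 'M[{poly F}]_(m, n)) : 'M[K]_(m, n) :=
  map_mx (@laurent_poly F) Z.

Lemma lmapM m n k (Z : 'M[{poly F}]_(m, n)) (W : 'M[{poly F}]_(n, k)) :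
  lmap (Z *m W) = lmap Z *m lmap W.
Proof. exact: map_mxM. Qed.

Lemma lmap1 n : lmap (1%:M : 'M[{poly F}]_n) = 1%:M.
Proof. exact: map_mx1. Qed.

Lemma lmap_inj m n : injective (@lmap m n).
Proof.
by move=> Z W /matrixP ZW; apply/matrixP => i j; have := ZW i j; rewrite !mxE => /lpoly_inj.
Qed.

Lemma lmap_mk2 (a b c d : {poly F}) : lmap (mk2 a b c d) =
  mk2 (laurent_poly a) (laurent_poly b) (laurent_poly c) (laurent_poly d).
Proof. by apply: mx2P; rewrite mk2E mxE mk2E. Qed.

Lemma lmap_unit (Z : 'M[{poly F}]_2) : \det Z != 0 -> invertible (lmap Z).
Proof. by rewrite invertible_det det_map_mx lpoly_eq0. Qed.

(** The value [1] for the singular matrices makes the action total, so that matrices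
    need not carry a proof of invertibility. *)
Definition GLof A : @GL2 F :=
  insubd (exist _ 1%:M (mem_set (unitmx1 K 2)) : @GL2 F) A.

Lemma val_GLof A : invertible A -> \val (GLof A) = A.
Proof. by move=> /invertibleP uA; rewrite val_insubd mem_set. Qed.

Lemma GLofK (g : @GL2 F) : GLof (\val g) = g.
Proof. exact: valKd. Qed.

Lemma val_unit (g : @GL2 F) : invertible (\val g).
Proof. by apply/invertibleP; exact: set_mem (valP g). Qed.

(** Locked for the same reason as [invertible]. *)
Definition mact : 'M[K]_2 -> hspace F -> hspace F :=
  locked (fun A x => act (GLof A) x).

Lemma mactE A x : mact A x = act (GLof A) x.
Proof. by rewrite /mact -lock. Qed.

Lemma act_mact (g : @GL2 F) x : act g x = mact (\val g) x.
Proof. by rewrite mactE GLofK. Qed.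

Lemma hspace_eqP x y : lattices x = lattices y -> x = y.
Proof.
case: x y => [x xP] [y yP] /= xy; move: xy xP yP => -> xP yP.
by congr HSpace; exact: Prop_irrelevance.
Qed.

Lemma lattices_mact A x : invertible A ->
  lattices (mact A x) = [set (fun w => A *m w) @` L | L in lattices x].
Proof. by move=> uA; rewrite mactE /= val_GLof. Qed.

Lemma mactM A B x : invertible A -> invertible B ->
  mact A (mact B x) = mact (A *m B) x.
Proof.
move=> uA uB; apply: hspace_eqP.
rewrite !lattices_mact//; last exact: invertibleM.
rewrite image_comp.
by apply: eq_imagel => L _ /=; rewrite image_comp; apply: eq_imagel => w _ /=; rewrite mulmxA.
Qed.

Lemma mact1 x : mact 1%:M x = x.
Proof.
apply: hspace_eqP; rewrite lattices_mact; last exact: invertible1.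
rewrite -[RHS]image_id; apply: eq_imagel => L _.
by rewrite -[RHS]image_id; apply: eq_imagel => w _; rewrite mul1mx.
Qed.

Lemma mactK A x : invertible A -> mact (minv A) (mact A x) = x.
Proof. by move=> uA; rewrite mactM ?mulVI ?mact1//; exact: invertibleV. Qed.

Lemma mact_scalar (c : K) x : c != 0 -> mact c%:M x = x.
Proof.
move=> c0; apply: hspace_eqP; rewrite lattices_mact; last exact: invertible_scalar.
have [L lL ->] := latticesP x; apply/seteqP; split=> [_ [_ [a /= a0 <-] <-]|_ [a /= a0 <-]].
  exists (c * a) => /=; first by rewrite mulf_neq0.
  by rewrite image_comp; apply: eq_imagel => w _ /=; rewrite mul_scalar_mx scalerA.
exists ((fun w => (c^-1 * a) *: w) @` L).
  by exists (c^-1 * a) => //=; rewrite mulf_neq0 ?invr_neq0.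
by rewrite image_comp; apply: eq_imagel => w _ /=; rewrite mul_scalar_mx scalerA mulVKf.
Qed.

Lemma mactZ (c : K) A x : invertible A -> c != 0 -> mact (c *: A) x = mact A x.
Proof.
by move=> uA c0; rewrite -mul_scalar_mx -mactM// ?mact_scalar//; exact: invertible_scalar.
Qed.

(** The lattice with basis the columns of [A]. *)
Definition lat A : set 'cV[K]_2 := [set A *m lmap r | r in [set: 'cV[{poly F}]_2]].

Definition cls : 'M[K]_2 -> hspace F := locked (fun A => mact A (base_point F)).

Lemma clsE A : cls A = mact A (base_point F).
Proof. by rewrite /cls -lock. Qed.

Lemma lattices_cls A : invertible A -> lattices (cls A) = homothety_class (lat A).
Proof.
move=> uA; rewrite clsE lattices_mact//=.
apply/seteqP; split=> [_ [_ [a /= a0 <-] <-]|_ [a /= a0 <-]].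
  exists a => //=; rewrite /lat /std_lattice !image_comp.
  by apply: eq_imagel => w _ /=; rewrite scalemxAr.
exists ((fun w => a *: w) @` @std_lattice F); first by exists a.
rewrite /lat /std_lattice !image_comp.
by apply: eq_imagel => w _ /=; rewrite scalemxAr.
Qed.

Lemma mact_cls A B : invertible A -> invertible B -> mact A (cls B) = cls (A *m B).
Proof. by move=> uA uB; rewrite !clsE mactM. Qed.

Lemma lat_mulr A (Z : 'M[{poly F}]_2) : Z \in unitmx -> lat (A *m lmap Z) = lat A.
Proof.
move=> uZ; apply/seteqP; split=> [_ [r _ <-]|_ [r _ <-]].
  by exists (Z *m r) => //; rewrite lmapM mulmxA.
exists (invmx Z *m r) => //.
by rewrite -mulmxA -lmapM mulKVmx.
Qed.

Lemma lmap_unitmx (Z : 'M[{poly F}]_2) : Z \in unitmx -> invertible (lmap Z).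
Proof.
move=> uZ; apply: lmap_unit; apply: contraTneq uZ => dZ.
by rewrite unitmxE dZ unitr0.
Qed.

Lemma lmapV (Z : 'M[{poly F}]_2) : Z \in unitmx -> lmap Z *m lmap (invmx Z) = 1%:M.
Proof. by move=> uZ; rewrite -lmapM mulmxV// lmap1. Qed.

Lemma lmap_scalar (p : {poly F}) : lmap (p%:M : 'M[{poly F}]_2) = (laurent_poly p)%:M.
Proof. exact: map_scalar_mx. Qed.

Lemma cls_mulr A (Z : 'M[{poly F}]_2) : invertible A -> Z \in unitmx ->
  cls (A *m lmap Z) = cls A.
Proof.
move=> uA uZ; apply: hspace_eqP.
rewrite !lattices_cls ?lat_mulr//.
by apply: invertibleM => //; exact: lmap_unitmx.
Qed.

Lemma cls_scale (c : K) A : invertible A -> c != 0 -> cls (c *: A) = cls A.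
Proof. by move=> uA c0; rewrite !clsE mactZ. Qed.

Lemma lat_refl A : invertible A -> lattices (cls A) (lat A).
Proof.
move=> uA; rewrite lattices_cls//; exists 1 => /=; first exact: oner_neq0.
by rewrite -[RHS]image_id; apply: eq_imagel => w _; rewrite scale1r.
Qed.

(** The columns of [Z] are the coordinates of the columns of [B] in the basis [A]. *)
Lemma lat_sub A B : lat B `<=` lat A -> exists Z : 'M[{poly F}]_2, B = A *m lmap Z.
Proof.
move=> BA; have col j : exists r, A *m lmap r = col j B.
  have [r _ rE] := BA (B *m lmap (delta_mx j 0)) (ex_intro2 _ _ _ I erefl).
  exists r; rewrite rE -[lmap _]/(map_mx _ _) map_delta_mx.
  by apply/esym/(@colE K).
have [f fP] := choice col; exists (\matrix_(i, j) f j i 0).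
apply/matrixP => i j; have /matrixP/(_ i 0) := fP j; rewrite [RHS]mxE => <-.
by rewrite !mxE; apply: eq_bigr => k _; rewrite !mxE.
Qed.

Lemma lat_mul_sub A (Z : 'M[{poly F}]_2) : lat (A *m lmap Z) `<=` lat A.
Proof. by move=> _ [r _ <-]; exists (Z *m r) => //; rewrite lmapM mulmxA. Qed.

Lemma lat_eqP A B : invertible A -> lat B = lat A ->
  exists2 Z : 'M[{poly F}]_2, Z \in unitmx & B = A *m lmap Z.
Proof.
move=> uA AB; have [|Z BZ] := @lat_sub A B; first by rewrite AB.
have [|W AW] := @lat_sub B A; first by rewrite AB.
exists Z => //; suff /mulmx1_unit[] : Z *m W = 1%:M by [].
apply: lmap_inj; rewrite lmapM lmap1; apply: (can_inj (mulIK uA)).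
by rewrite mulmxA -BZ -AW mulmx1.
Qed.

Lemma lat_scale (c : K) A : (fun w => c *: w) @` lat A = lat (c *: A).
Proof. by rewrite /lat image_comp; apply: eq_imagel => r _ /=; rewrite scalemxAl. Qed.

Lemma cls_rep A L : invertible A -> lattices (cls A) L ->
  exists2 c : K, c != 0 & L = lat (c *: A).
Proof.
by move=> uA; rewrite lattices_cls// => -[c /= c0 <-]; exists c; rewrite ?lat_scale.
Qed.

Lemma cls_eqP A B : invertible A -> invertible B -> cls B = cls A ->
  exists c : K, exists Z : 'M[{poly F}]_2,
    [/\ c != 0, Z \in unitmx & B = c *: (A *m lmap Z)].
Proof.
move=> uA uB AB; have := lat_refl uB; rewrite AB => /(cls_rep uA)[c c0 /lat_eqP[]].
  exact: invertibleZ.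
by move=> Z uZ BE; exists c, Z; split=> //; rewrite scalemxAl.
Qed.

Lemma cls_ex x : exists2 A, invertible A & x = cls A.
Proof.
have [L [u [v [LE uvf uvs]]] xL] := latticesP x.
pose A : 'M[K]_2 := \matrix_(i, j) if j == 0 then u i 0 else v i 0.
have AE r : A *m r = r 0 0 *: u + r 1 0 *: v.
  by apply/matrixP => i j; rewrite (ord1 j) mulcv2E !mxE mulrC; congr (_ + _); rewrite mulrC.
have uA : invertible A.
  have [a [b e0E]] := uvs (delta_mx 0 0).
  have [c [d e1E]] := uvs (delta_mx 1 0).
  apply: (@invertible_right _ _ (mk2 a c b d)).
  apply/matrixP => i; apply: ord2P.
    have /matrixP/(_ i 0) := e0E; rewrite mulmx2E !mk2E !mxE/=.
    by rewrite andbT mulrC (mulrC b) => <-.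
  have /matrixP/(_ i 0) := e1E; rewrite mulmx2E !mk2E !mxE/=.
  by rewrite andbT mulrC (mulrC d) => <-.
exists A => //; apply: hspace_eqP; rewrite lattices_cls// xL; congr homothety_class.
rewrite LE; apply/seteqP; split=> [_ [p _ <-]|_ [r _ <-]].
  exists (\col_i if i == 0 then p.1 else p.2) => //.
  by rewrite AE !mxE.
by exists (r 0 0, r 1 0) => //=; rewrite AE !mxE.
Qed.

End Classes.

(** * The topology of the space of lattices *)

Section Topology.
Variable F : finFieldType.
Local Notation K := (laurent F).
Implicit Types (A B : 'M[K]_2) (x y z : hspace F) (s t : nat).

Lemma nbhs_laurentP (a : K) (P : set K) :
  nbhs a P <-> exists d, forall b, bnd d (b - a) -> P b.
Proof.
split=> [|[d dP]].
  rewrite nbhsE => -[U [oU /oU[n nU]] UP]; exists (n - 1) => b ba; apply/UP/nU => k nk.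
  by apply/eqP; rewrite -subr_eq0; apply/eqP; apply: (ba k); lia.
rewrite nbhsE; exists [set b | bnd d (b - a)]; last by move=> b /dP.
split; last by rewrite /= subrr; exact: bnd0.
suff oB : laurent_open [set b | bnd d (b - a)] by exact: oB.
move=> b /= ba; exists (d + 1) => c cb /= k dk.
have := ba k dk; rewrite !lcoefB => <-; congr (_ - _); apply: cb; lia.
Qed.

Lemma nbhs_mxP A (P : set 'M[K]_2) :
  nbhs A P <-> exists d : nat, forall B, mbnd (- d%:Z) (B - A) -> P B.
Proof.
split=> [[Q AQ QP]|[d dP]].
  have [d dQ] := choice (fun i : 'I_2 * 'I_2 => (nbhs_laurentP _ _).1 (AQ i.1 i.2)).
  exists (\max_i `|d i|)%N => B BA; apply: QP => i j.
  apply: (dQ (i, j)) => /=; have := BA i j; rewrite !mxE; apply: bndW.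
  have : (`|d (i, j)| <= \max_i `|d i|)%N.
    exact: (leq_bigmax (F := fun i => `|d i|%N)).
  lia.
exists (fun i j => [set b | bnd (- d%:Z) (b - A i j)]).
  by move=> i j; apply/nbhs_laurentP; exists (- d%:Z).
by move=> B BA; apply: dP => i j; rewrite !mxE; exact: BA.
Qed.

(** The neighbourhoods of [A] in the matrices are those of the products [B *m A]
    with [B] close to [1], up to a shift of the precision that depends on [A]; this
    makes left multiplication, hence the action, local at the identity. *)
Lemma hspace_openP (U : set (hspace F)) :
  open U <-> forall y, U y -> exists s, forall A, near1 s A -> U (mact A y).
Proof.
split=> [[V oV VU] y Uy|H].
  have [A iA yE] := cls_ex y.
  have VA : V A.
    rewrite -[A]val_GLof//; change ((@set_val _ _ @^-1` V) (GLof A)).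
    by rewrite VU /= -mactE -clsE -yE.
  have : nbhs A V by apply: open_nbhs_nbhs.
  move=> /nbhs_mxP[d dP]; have [c cP] := mbnd_ex A.
  exists (d + c)%N => B Bs; have iB := near1_unit Bs.
  have : V (B *m A).
    apply: dP; rewrite -{2}(mul1mx A) -mulmxBl; apply: mbndMW Bs cP; lia.
  rewrite yE mact_cls// clsE mactE; have iBA := invertibleM iB iA.
  rewrite -{1}(val_GLof iBA) => VBA.
  suff : ((fun g : @GL2 F => act g (@base_point F)) @^-1` U) (GLof (B *m A)) by [].
  by rewrite -VU.
exists [set A | invertible A /\ U (cls A)].
  rewrite openE => A [iA /H[s sU]]; apply/nbhs_mxP.
  have [C CP] := near1_quot iA; exists (s + C)%N => B /CP BA.
  have -> : B = B *m minv A *m A by rewrite mulKVI.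
  split; first exact: invertibleM (near1_unit BA) iA.
  by rewrite -mact_cls//; [exact: sU|exact: near1_unit BA].
apply/seteqP; split=> g /=.
  by move=> [_]; rewrite clsE mactE GLofK.
by rewrite clsE mactE GLofK; split=> //; exact: val_unit.
Qed.

(** The orbits of the congruence subgroups: for every [s] they partition the space of
    lattices, into compact open sets. *)
Definition nhd s y : set (hspace F) := [set mact A y | A in near1 s].

Definition invariant s (W : set (hspace F)) :=
  forall A y, near1 s A -> W y -> W (mact A y).

Lemma invariantE s W A y : invariant s W -> near1 s A -> W (mact A y) <-> W y.
Proof.
move=> Wi As; split=> [|]; last exact: Wi.
by move=> /(Wi _ _ (near1V As)); rewrite mactK//; exact: near1_unit As.
Qed.

Lemma invariantW s t W : (s <= t)%N -> invariant s W -> invariant t W.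
Proof. by move=> st Wi A y At; apply: Wi; exact: near1W At. Qed.

Lemma invariant_open s W : invariant s W -> open W.
Proof. by move=> Wi; apply/hspace_openP => y Wy; exists s => A As; exact: Wi. Qed.

Lemma invariantC s W : invariant s W -> invariant s (~` W).
Proof. by move=> Wi A y As; rewrite /= (invariantE _ Wi As). Qed.

Lemma invariantI s W W' : invariant s W -> invariant s W' -> invariant s (W `&` W').
Proof. by move=> Wi Wi' A y As [/(Wi _ _ As) ? /(Wi' _ _ As)]. Qed.

Lemma invariantU s W W' : invariant s W -> invariant s W' -> invariant s (W `|` W').
Proof. by move=> Wi Wi' A y As [/(Wi _ _ As)|/(Wi' _ _ As)]; [left|right]. Qed.

Lemma invariant_closed s W : invariant s W -> closed W.
Proof. by move=> Wi; rewrite -openC; apply: invariant_open (invariantC Wi). Qed.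

Lemma nhd_refl s y : nhd s y y.
Proof. by exists 1%:M; [exact: near1_1 | rewrite mact1]. Qed.

Lemma nhd_invariant s y : invariant s (nhd s y).
Proof.
move=> A _ As [B Bs <-]; exists (A *m B); first exact: near1M.
by rewrite mactM//; [exact: near1_unit As|exact: near1_unit Bs].
Qed.

Lemma nhd_sym s y z : nhd s y z -> nhd s z y.
Proof.
move=> [A As <-]; exists (minv A); first exact: near1V.
by rewrite mactK//; exact: near1_unit As.
Qed.

Lemma nhd_trans s x y z : nhd s x y -> nhd s y z -> nhd s x z.
Proof. by move=> xy [A As <-]; apply: nhd_invariant. Qed.

Lemma nbhs_hspaceP y (P : set (hspace F)) : nbhs y P <-> exists s, nhd s y `<=` P.
Proof.
split=> [|[s sP]]; rewrite nbhsE.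
  move=> [U [/hspace_openP oU /oU[s sU]] UP]; exists s => _ [A As <-].
  exact/UP/sU.
exists (nhd s y) => //; split; last exact: nhd_refl.
exact: invariant_open (@nhd_invariant _ _).
Qed.

Lemma mact_continuous A : invertible A -> continuous (mact A).
Proof.
move=> iA y P /nbhs_hspaceP[s sP]; apply/nbhs_hspaceP.
have [C CP] := near1_conj iA; exists (s + C)%N => _ [B Bs <-].
apply: sP; exists (A *m B *m minv A); first exact: CP.
have iB := near1_unit Bs.
rewrite -mactM//; last exact: invertibleV.
  by rewrite mactK// mactM.
exact: invertibleM.
Qed.

End Topology.

(** * Compactness and separation *)

Section Separation.
Variable F : finFieldType.
Local Notation K := (laurent F).
Implicit Types (A B : 'M[K]_2) (x y z : hspace F) (s t : nat).

Lemma ultra_finite (T : Type) (I : finType) (f : T -> I) (U : set_system T) :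
  UltraFilter U -> exists i, U [set z | f z = i].
Proof.
move=> UU; apply: contrapT => /forallNP H.
have HC i : U [set z | f z <> i].
  by have [/H|] := in_ultra_setVsetC [set z | f z = i] UU.
have UH : U [set z | forall i, f z <> i] by exact: filter_forall.
by have [z /(_ (f z))] := filter_ex UH.
Qed.

(** Every coefficient of the matrices takes finitely many values, hence is
    eventually constant along an ultrafilter; these constants are the coefficients
    of a limit. *)
Lemma compact_mact_image (S : set 'M[K]_2) (n : nat) y :
  (forall A, S A -> invertible A /\ mbnd n%:Z A) ->
  (forall L, (forall t, exists2 A, S A & mbnd (- t%:Z) (A - L)) -> S L) ->
  compact [set mact A y | A in S].
Proof.
move=> Sb Scl; rewrite compact_ultra => U UU US.
have [f fP] : exists f, forall z, [set mact A y | A in S] z -> S (f z) /\ mact (f z) y = z.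
  have ex z : exists A, [set mact A y | A in S] z -> S A /\ mact A y = z.
    have [[A SA Az]|nz] := pselect ([set mact A y | A in S] z).
      by exists A.
    by exists 0 => /nz.
  by have [f fP] := choice ex; exists f.
have ev (q : ('I_2 * 'I_2) * int) : exists c, U [set z | f z q.1.1 q.1.2 q.2 = c].
  exact: ultra_finite.
have [c cP] := choice ev.
have c0 i j k : n%:Z < k -> c (i, j, k) = 0.
  move=> nk; have [z [/fP[/Sb[_ fz] _] <-]] := filter_ex (filterI US (cP (i, j, k))).
  exact: fz.
pose L : 'M[K]_2 := \matrix_(i, j)
  Laurent (ex_intro (fun N : int => forall k, N < k -> c (i, j, k) = 0) n%:Z (@c0 i j)).
have near t : U [set z | mbnd (- t%:Z) (f z - L)].
  have : U [set z | forall q : ('I_2 * 'I_2) * 'I_(n + t),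
      f z q.1.1 q.1.2 (n%:Z - q.2%:Z) = c (q.1, n%:Z - q.2%:Z)].
    by apply: filter_forall => -[[i j] k]; exact: cP (i, j, _).
  move=> /(filterI US); apply: filterS => z [/fP[/Sb[_ fz] _] H] i j k tk.
  rewrite !mxE lcoefB /=.
  have [nk|kn] := ltP n%:Z k; first by rewrite fz// c0// subrr.
  have kt : (`|n%:Z - k| < n + t)%N by lia.
  have /= := H (i, j, Ordinal kt).
  by rewrite (_ : n%:Z - _ = k) => [->|]; [rewrite subrr|lia].
have SL : S L.
  apply: Scl => t.
  by have [z [/fP[Sz _] zL]] := filter_ex (filterI US (near t)); exists (f z).
have [iL _] := Sb _ SL.
exists (mact L y); split; first by exists L.
move=> P /nbhs_hspaceP[s sP].
have [C CP] := near1_quot iL.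
suff H : U P by exact: H.
apply: filterS (filterI US (near (s + C)%N)) => z [/fP[_ fz] /CP fL].
apply: sP; exists (f z *m minv L); first exact: fL.
by rewrite (mactM _ (near1_unit fL) iL) (mulKVI _ iL).
Qed.

Lemma nhd_compact s y : compact (nhd s y).
Proof.
apply: (@compact_mact_image _ 0) => [A As|L LP].
  by split; [exact: near1_unit As|exact: near1_int As].
have [A As AL] := LP s.+1; rewrite /near1 (_ : L - 1%:M = (A - 1%:M) - (A - L)).
  exact: mbndB.
by rewrite opprB [RHS]addrC addrA subrK.
Qed.

Lemma near1_entries s A : near1 s A ->
  [/\ lunit (A 0 0), bnd (- s.+1%:Z) (A 0 1), bnd (- s.+1%:Z) (A 1 0)
    & bnd (- s.+1%:Z) (A 0 0 - A 1 1)].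
Proof.
move=> As; have e i j := As i j.
have e00 := e 0 0; have e01 := e 0 1; have e10 := e 1 0; have e11 := e 1 1.
rewrite !mxE /= ?subr0 in e00 e01 e10 e11.
split=> //; first by apply: lunit_near1 e00; lia.
by rewrite (_ : _ - _ = (A 0 0 - 1) - (A 1 1 - 1)); [exact: bndB|ring].
Qed.

Lemma det_poly_unit (Z : 'M[{poly F}]_2) : Z \in unitmx ->
  lunit (laurent_poly (\det Z)).
Proof.
rewrite unitmxE poly_unitE => /andP[/size_poly1P[c c0 ->] _].
by rewrite lpolyC; split; [move=> k k0 /=; rewrite gt_eqF | rewrite /= ].
Qed.

Lemma lunit_sqr (c : K) : c != 0 -> lunit (c ^+ 2) -> lunit c.
Proof.
move=> /degree_ex[d [cd c0]] [H0 H].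
have E := lcoefM_lead cd cd; rewrite -expr2 in E.
have E0 : (c ^+ 2) (d + d) != 0 by rewrite E mulf_neq0.
have d1 : d + d <= 0 by rewrite leNgt; apply: contraNN E0 => /H0 ->.
have d2 : 0 <= d + d.
  by rewrite leNgt; apply: contraNN H => /(bndM cd cd); rewrite -expr2 => ->.
have dE : d = 0 by lia.
by rewrite dE in cd c0; split.
Qed.

(** In the basis [A], an element [B] of the stabilizer becomes [c *: lmap Z] with
    [Z] integral. If this is close to [1], then [c] is a unit of the valuation ring,
    and the entries of [Z] that must be small are polynomials of negative degree. *)
Lemma stab_discrete A : invertible A -> exists s, forall B, near1 s B ->
  mact B (cls A) = cls A -> exists2 c : K, c != 0 & B = c%:M.
Proof.
move=> iA; have [C CP] := near1_conj (invertibleV iA); exists (0 + C)%N => B Bs.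
have iB := near1_unit Bs; rewrite mact_cls// => /cls_eqP[]//; first exact: invertibleM.
move=> c [Z [c0 uZ BA]]; have := CP 0%N B Bs; rewrite minvK.
have BA' : c *: lmap Z = minv A *m B *m A.
  by rewrite -mulmxA BA KscaleAr (mulIK iA); reflexivity.
rewrite -BA' => N1; have uc : lunit c.
  apply: lunit_sqr => //; have dZ := det_poly_unit uZ.
  have := near1_det N1; rewrite (@detZ K) det_map_mx => /lunitM/(_ (lunitV dZ)).
  by rewrite mulfK//; exact: lunit_neq0.
have [_ n01 n10 n11] := near1_entries N1.
have small (a : {poly F}) : bnd (-1) (c * laurent_poly a) -> a = 0.
  move=> ca; apply: lpoly_small; rewrite -(mulKf c0 (laurent_poly a)).
  by apply: bndMW (lunitV uc).1 ca.
rewrite !mxE -?mulrBr -?rmorphB in n01 n10 n11.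
have Z01 := small _ n01; have Z10 := small _ n10; have /subr0_eq Z11 := small _ n11.
have ZE : Z = (Z 0 0)%:M.
  by apply: mx2P; rewrite ?mxE ?Z01 ?Z10 ?Z11.
have NE : c *: lmap Z = (c * laurent_poly (Z 0 0))%:M.
  by apply: mx2P; rewrite !mxE ?Z01 ?Z10 -?Z11 ?rmorph0 ?mulr0.
exists (c * laurent_poly (Z 0 0)).
  by have [/lunit_neq0] := near1_entries N1; rewrite !mxE.
have AB : minv A *m B = (c * laurent_poly (Z 0 0))%:M *m minv A.
  by rewrite -NE BA'  mulKI.
rewrite -(mulVIK iA B) AB Kmul_scalar_mx KscaleAr mulIV//.
by rewrite [RHS]Kscalar1.
Qed.

(** Let [B] send [y] to [z]. Any other such matrix differs from [B] by a scalar, because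
    the stabilizer of [y] is discrete; so [B] is, up to scalars, arbitrarily close to
    [1], and is itself a scalar. *)
Lemma nhd_separated y z : (forall s, nhd s y z) -> z = y.
Proof.
have [A iA ->] := cls_ex y; have [s0 s0P] := stab_discrete iA => yz.
have [B Bs Bz] := yz s0.
have iB := near1_unit Bs.
have Bsc s : exists c B', [/\ lunit c, near1 s B' & B = c *: B'].
  have [C Cs Cz] := yz (maxn s s0).
  have Cs0 := near1W (leq_maxr _ _) Cs.
  have iC := near1_unit Cs0.
  have [||c c0 E] := s0P (minv C *m B).
  - by apply: near1M Bs; exact: near1V.
  - by rewrite -mactM ?Bz -?Cz ?mactK//; exact: invertibleV.
  have BE : B = c *: C.
    by rewrite -(mulVIK iC B) E mul_mx_scalar.
  exists c, C; split=> //; last exact: near1W (leq_maxl _ _) Cs.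
  have [lB _ _ _] := near1_entries Bs; have [lC _ _ _] := near1_entries Cs.
  move: lB; rewrite BE mxE => /lunitM/(_ (lunitV lC)).
  by rewrite mulfK//; exact: lunit_neq0.
have small s : [/\ bnd (- s.+1%:Z) (B 0 1), bnd (- s.+1%:Z) (B 1 0)
    & bnd (- s.+1%:Z) (B 0 0 - B 1 1)].
  have [c [C [[c0 _] Cs ->]]] := Bsc s.
  have [_ n01 n10 n11] := near1_entries Cs.
  by rewrite !mxE -mulrBr; split; apply: bndMW c0 _; eauto; rewrite add0r.
have all0 (a : K) : (forall s, bnd (- s.+1%:Z) a) -> a = 0.
  by move=> H; apply: bnd_all => d; apply: bndW (H `|d|%N); lia.
have B01 : B 0 1 = 0 by apply: all0 => s; have [] := small s.
have B10 : B 1 0 = 0 by apply: all0 => s; have [] := small s.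
have B11 : B 1 1 = B 0 0.
  by apply/esym/subr0_eq/all0 => s; have [] := small s.
have BE : B = (B 0 0)%:M.
  by apply: mx2P; rewrite ?mxE ?B01 ?B10 ?B11.
rewrite -Bz BE mact_scalar//.
by have [/lunit_neq0] := near1_entries Bs.
Qed.

Lemma hspace_hausdorff : hausdorff_space (hspace F).
Proof.
move=> y z yz; apply/esym/nhd_separated => s.
have [||u [yu zu]] := yz (nhd s y) (nhd s z).
- by apply/nbhs_hspaceP; exists s.
- by apply/nbhs_hspaceP; exists s.
by apply: nhd_trans yu _; exact: nhd_sym.
Qed.

Lemma laurent_dense (d : nat) (a : K) : exists q : {poly F} * nat,
  bnd (- d%:Z) (laurent_poly q.1 * Ymon F (- q.2%:Z) - a).
Proof.
exists (polypart (a * Ymon F d%:Z), d) => /=.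
have -> : laurent_poly (polypart (a * Ymon F d%:Z)) * Ymon F (- d%:Z) - a =
    - ((a * Ymon F d%:Z - laurent_poly (polypart (a * Ymon F d%:Z))) * Ymon F (- d%:Z)).
  by rewrite mulrBl -mulrA -YmonD subrr mulr1 opprB.
by apply: bndN; apply: bndMW (polypartP _) (@Ymon_bnd _ _); lia.
Qed.

(** The matrices over [F[Y][1/Y]] are countable and dense. *)
Lemma countable_orbits s : exists y_ : nat -> hspace F, forall z, exists n, nhd s (y_ n) z.
Proof.
pose T := ('M[{poly F} * nat]_2 : countType).
pose m (q : T) : 'M[K]_2 := \matrix_(i, j) (laurent_poly (q i j).1 * Ymon F (- (q i j).2%:Z)).
exists (fun n => if unpickle n is Some q then cls (m q) else @base_point F) => z.
have [A iA ->] := cls_ex z; have [C CP] := near1_quot iA.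
have [q qP] := choice (fun ij : 'I_2 * 'I_2 => laurent_dense (s + C) (A ij.1 ij.2)).
exists (pickle (\matrix_(i, j) q (i, j) : T)); rewrite pickleK.
set B := m _; apply: nhd_sym; have BA : near1 s (B *m minv A).
  by apply: CP => i j; rewrite !mxE; exact: qP (i, j).
exists (B *m minv A) => //.
by rewrite mact_cls ?mulKVI//; exact: near1_unit BA.
Qed.

End Separation.

(** * Diagonal orbits and their periods *)

Section DiagonalAction.
Variable F : finFieldType.
Local Notation K := (laurent F).
Implicit Types (A B : 'M[K]_2) (x y z : hspace F) (s t : nat) (a b u : K).

(** Modulo scalars, the diagonal group is [K^*]. *)
Definition dg a : 'M[K]_2 := mk2 a 0 0 1.

Definition tor a x := mact (dg a) x.

Lemma dg_invertible a : a != 0 -> invertible (dg a).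
Proof. by move=> a0; apply/invertible_mk2; rewrite mulr1 mulr0 subr0. Qed.

Lemma dgM a b : dg a *m dg b = dg (a * b).
Proof. by rewrite /dg mk2M !(mulr0, mul0r, mulr1, addr0, add0r). Qed.

Lemma dg1 : dg 1 = 1%:M.
Proof. exact: mk2_1. Qed.

Lemma torM a b x : a != 0 -> b != 0 -> tor a (tor b x) = tor (a * b) x.
Proof.
by move=> a0 b0; rewrite /tor mactM ?dgM//; exact: dg_invertible.
Qed.

Lemma tor1 x : tor 1 x = x.
Proof. by rewrite /tor dg1 mact1. Qed.

Lemma torK a x : a != 0 -> tor a^-1 (tor a x) = x.
Proof. by move=> a0; rewrite torM ?invr_neq0// mulVf// tor1. Qed.

Lemma torKV a x : a != 0 -> tor a (tor a^-1 x) = x.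
Proof. by move=> a0; rewrite torM ?invr_neq0// divff// tor1. Qed.

Lemma diag_tor (a b : K) x : a != 0 -> b != 0 ->
  mact (mk2 a 0 0 b) x = tor (a / b) x.
Proof.
move=> a0 b0; have -> : mk2 a 0 0 b = b *: dg (a / b).
  by apply: mx2P; rewrite !mxE /= ?mulr0 ?mulr1 // mulrC divfK.
by rewrite mactZ//; apply: dg_invertible; rewrite mulf_neq0 ?invr_neq0.
Qed.

Lemma diag_mx_tor A : is_diag_mx A -> invertible A ->
  exists2 a : K, a != 0 & forall x, mact A x = tor a x.
Proof.
move=> dA; rewrite (diag_mk2 dA) => /invertible_mk2.
rewrite mul0r subr0 mulf_eq0 negb_or => /andP[g0 g1].
by exists (A 0 0 / A 1 1) => [|x]; rewrite ?diag_tor// mulf_neq0 ?invr_neq0.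
Qed.

Lemma act_diag_tor (g : @GL2 F) : is_diag_mx (\val g) ->
  exists2 a : K, a != 0 & forall x, act g x = tor a x.
Proof.
move=> /diag_mx_tor/(_ (val_unit g))[a a0 aP].
by exists a => // x; rewrite act_mact; exact: aP.
Qed.

Lemma diag_orbitE x : diag_orbit x = [set tor a x | a in [set a | a != 0]].
Proof.
apply/seteqP; split=> [_ [g /= /act_diag_tor[a a0 aP] <-]|_ [a /= a0 <-]].
  by exists a.
exists (GLof (dg a)) => /=; last by rewrite -mactE.
by rewrite val_GLof; [exact: mk2_diag|exact: dg_invertible].
Qed.

Lemma tor_compact (Q : nat) x :
  compact [set tor a x | a in [set a | bnd Q%:Z a /\ ~ bnd (-1) a]].
Proof.
have -> : [set tor a x | a in [set a | bnd Q%:Z a /\ ~ bnd (-1) a]] =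
    [set mact A x | A in [set dg a | a in [set a | bnd Q%:Z a /\ ~ bnd (-1) a]]].
  by rewrite image_comp.
apply: (@compact_mact_image _ _ Q) => [_ [a [aQ a0] <-]|L LP].
  split; first by apply: dg_invertible; apply: contra_notN a0 => /eqP ->; exact: bnd0.
  apply: mk2_mbnd => //.
  by apply: bndW (lunit1 F).1; lia.
have entry i j (e : K) : (forall a, dg a i j = e) -> L i j = e.
  move=> E; apply/eqP; rewrite eq_sym -subr_eq0; apply/eqP/bnd_all => d.
  have [_ [a _ <-] H] := LP `|d|%N.
  have -> : e - L i j = (dg a - L) i j by rewrite mxE E !mxE.
  by apply: bndW (H i j); lia.
have LE : L = dg (L 0 0).
  apply: mx2P; rewrite mk2E//; apply: entry => a; by rewrite mk2E.
rewrite LE; exists (L 0 0) => //=.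
have [_ [a [aQ a0] <-] H] := LP 1%N.
have := H 0 0; rewrite !mxE /= => aL; split.
  rewrite -(subKr a (L 0 0)); apply: bndB => //; apply: bndW aL; lia.
by apply: contra_not a0 => L0; rewrite -(subrK (L 0 0) a); exact: bndD.
Qed.

Lemma lunitP u : lunit u <-> bnd 0 u /\ ~ bnd (-1) u.
Proof.
split=> -[u0 u1]; split=> //; first by apply: contraNnot u1 => /(_ 0) ->.
apply/eqP => u2; apply: u1 => k k1; have [->//|k0] := eqVneq k 0.
by apply: u0; lia.
Qed.

Definition uorb x := [set tor u x | u in [set u | lunit u]].

Lemma uorb_compact x : compact (uorb x).
Proof.
rewrite (_ : uorb x = [set tor a x | a in [set a | bnd 0%:Z a /\ ~ bnd (-1) a]]).
  exact: tor_compact.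
by congr (image _ _); apply/funext => u /=; apply/propext/lunitP.
Qed.

(** A period for the action of the powers of [Y] on the orbits of the group of units. *)
Definition period (Q : nat) x := exists2 u, lunit u & tor (Ymon F Q%:Z * u) x = x.

Lemma Ymon_unit_neq0 (i : int) u : lunit u -> Ymon F i * u != 0.
Proof. by move=> uu; rewrite mulf_neq0 ?Ymon_neq0//; exact: lunit_neq0. Qed.

Lemma YmonM_nat (i j : nat) : Ymon F i%:Z * Ymon F j%:Z = Ymon F (i + j)%N%:Z.
Proof. by rewrite -YmonD PoszD. Qed.

Lemma periodM (Q k : nat) x : period Q x -> period (Q * k) x.
Proof.
move=> [u uu ux]; elim: k => [|k [v uv IH]].
  by exists 1; [exact: lunit1|rewrite muln0 Ymon0 mulr1 tor1].
exists (v * u); first exact: lunitM.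
have -> : Ymon F (Q * k.+1)%N%:Z * (v * u) =
    (Ymon F (Q * k)%N%:Z * v) * (Ymon F Q%:Z * u).
  by rewrite mulnS addnC -YmonM_nat; ring.
by rewrite -torM ?ux ?IH//; exact: Ymon_unit_neq0.
Qed.

Lemma period_orbit Q x a : a != 0 -> period Q x -> period Q (tor a x).
Proof.
move=> a0 [u uu ux]; exists u => //.
by rewrite torM ?Ymon_unit_neq0// mulrC -torM ?ux// Ymon_unit_neq0.
Qed.

(** Write [a] as a power of [Y] times a unit: the exponent matters only modulo [Q],
    so that finitely many translates of the orbit of the units cover the orbit. *)
Lemma period_compact Q x : (0 < Q)%N -> period Q x -> diag_periodic x.
Proof.
move=> Q0 px; rewrite /diag_periodic diag_orbitE.
have -> : [set tor a x | a in [set a | a != 0]] =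
    [set tor a x | a in [set a | bnd Q%:Z a /\ ~ bnd (-1) a]].
  apply/seteqP; split=> [_ [a /= a0 <-]|_ [a /= [_ a1] <-]]; last first.
    by exists a => //=; apply: contra_notN a1 => /eqP ->; exact: bnd0.
  have [d] := degreeP a0; set w := _ * a => uw ->.
  have Q0' : Q%:Z != 0 by case: Q Q0 px.
  have dE := divz_eq d Q%:Z; have r0 := modz_ge0 d Q0'; have := ltz_mod d Q0'.
  rewrite [X in _ < X]ger0_norm//; set r := (d %% _)%Z in dE r0 *.
  set k := (d %/ _)%Z in dE * => rQ.
  suff [v uv ->] : exists2 v, lunit v & tor (Ymon F d * w) x = tor (Ymon F r * v) x.
    exists (Ymon F r * v) => //=; split.
      by apply: bndMW (@Ymon_bnd _ _) uv.1; lia.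
    move=> /(_ r) H; have := uv.2; rewrite -(subrr r) -YmonM H ?eqxx//; lia.
  have [u uu ux] := periodM `|k|%N px.
  have u0 := lunit_neq0 uu; have Y0 := Ymon_neq0 F.
  have [k0|k0] := leP 0 k.
    exists (w / u); first exact: lunitM uw (lunitV uu).
    rewrite -[in RHS]ux torM ?Ymon_unit_neq0//; last exact: lunitM uw (lunitV uu).
    congr tor; rewrite (_ : d = r + (Q * `|k|)%N%:Z); last by lia.
    by rewrite YmonD; field.
  exists (w * u); first exact: lunitM.
  rewrite -[in LHS]ux torM ?Ymon_unit_neq0//.
  congr tor; rewrite (_ : r = d + (Q * `|k|)%N%:Z); last by lia.
  by rewrite YmonD; ring.
exact: tor_compact.
Qed.

End DiagonalAction.

(** * Invariant measures of periodic orbits *)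

Section ProbabilityFacts.
Context d (T : measurableType d) (R : realType) (m : probability T R).
Implicit Types (A D : set T).
Local Open Scope ereal_scope.

Lemma probability_setI1 A D : measurable A -> measurable D -> m D = 1 ->
  m (A `&` D) = m A.
Proof.
move=> mA mD D1; have mDC : measurable (~` D) by exact: measurableC.
have D0 : m (~` D) = 0 by rewrite probability_setC// D1 subee.
have AD0 : m (A `\` D) = 0.
  by apply: (subset_measure0 _ _ _ D0) => //; exact: measurableD.
by have := measureDI m mA mD; rewrite /= AD0 add0e => ->.
Qed.

(** Integrate the number of the sets that contain a point. *)
Lemma finite_average D (I : Type) (s : seq I) (A : I -> set T) (p : \bar R) (n : nat) :
  measurable D -> m D = 1 -> (forall i, measurable (A i)) ->
  (forall i, m (A i) = p) ->
  (forall z, D z -> (\sum_(i <- s) `[< A i z >])%N = n) ->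
  p *+ size s = n%:R%:E.
Proof.
move=> mD D1 mA Ap AD.
have : \int[m]_(z in D) (\sum_(i <- s) (\1_(A i) z)%:E) = n%:R%:E * m D.
  rewrite -integral_cst//; apply: eq_integral => z; rewrite inE => /AD <-.
  rewrite sumEFin /= natr_sum; congr EFin; apply: eq_bigr => i _.
  rewrite D1 mule1 => <-; rewrite ge0_integral_sum//; last first.
  by move=> i; apply/measurable_EFinP; exact: measurable_indic.
rewrite (eq_bigr (fun=> p)) => [|i _]; last first.
  by rewrite integral_indic// -(Ap i); exact: probability_setI1.
by rewrite big_const_seq count_predT iter_addr addr0.
Qed.

Lemma equal_disjoint_null (A : nat -> set T) : (forall i, measurable (A i)) ->
  trivIset setT A -> (forall i, m (A i) = m (A 0%N)) -> m (A 0%N) = 0.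
Proof.
move=> mA tA Aeq; have A0 : 0 <= m (A 0%N) by [].
have fA : m (A 0%N) \is a fin_num by exact: fin_num_measure.
apply/eqP; rewrite eq_le A0 andbT leNgt; apply/negP => Apos.
have le1 n : (fine (m (A 0%N)) *+ n <= 1)%R.
  rewrite -lee_fin EFin_natmul fineK//.
  apply: le_trans (probability_le1 m (bigcupT_measurable _ mA)).
  rewrite measure_bigcup//.
  have H := @nneseries_lim_ge R (fun i => m (A i)) (fun i => i \in setT) 0 n (fun i _ _ => measure_ge0 m (A i)).
  apply: (le_trans _ H).
  rewrite (eq_bigl xpredT); last by move=> i; apply/asboolP.
  by rewrite (eq_bigr (fun=> m (A 0%N)))// sumr_const_nat subn0.
have Ar : (0 < fine (m (A 0%N)))%R by rewrite fine_gt0// Apos ltey_eq fA.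
have := le1 (Num.Def.archi_bound (fine (m (A 0%N)))^-1).
rewrite leNgt -mulr_natl -ltr_pdivrMr// div1r archi_boundP//.
by rewrite invr_ge0 ltW.
Qed.

End ProbabilityFacts.

Section PeriodicMeasures.
Variables (F : finFieldType) (R : realType).
Local Notation K := (laurent F).
Implicit Types (x y z : hspace F) (s : nat) (a u v : K) (m : probability (borel F) R).

Lemma open_measurable_borel (U : set (hspace F)) : open U -> measurable (U : set (borel F)).
Proof. exact: sub_sigma_algebra. Qed.

Lemma closed_measurable_borel (C : set (hspace F)) : closed C -> measurable (C : set (borel F)).
Proof.
move=> cC; rewrite -(setCK C); apply: measurableC.
by apply: open_measurable_borel; exact: closed_openC.
Qed.

Lemma compact_measurable_borel (C : set (hspace F)) : compact C -> measurable (C : set (borel F)).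
Proof.
by move=> cC; apply: closed_measurable_borel; exact: compact_closed (@hspace_hausdorff F) cC.
Qed.

Lemma tor_preimage a (E : set (hspace F)) : a != 0 ->
  tor a @^-1` E = [set tor a^-1 z | z in E].
Proof.
move=> a0; apply/seteqP; split=> [z Ez|_ [z Ez <-]].
  by exists (tor a z); rewrite ?torK.
by rewrite /= torKV.
Qed.

Lemma orbit_measure_tor x m a (E : set (borel F)) : orbit_measure x m -> a != 0 ->
  measurable E -> m (tor a @^-1` E) = m E.
Proof.
move=> [_ mi] a0 mE; have ia := dg_invertible a0.
have gd : is_diag_mx (\val (GLof (dg a))) by rewrite val_GLof//; exact: mk2_diag.
rewrite -[RHS](mi _ gd)//.
by congr (m (_ @^-1` E)); apply/funext => z; rewrite /tor mactE.
Qed.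

(** The orbit is the union of the translates by the powers of [Y] of an orbit
    of the group of units, and these have the same measure: an aperiodic orbit
    would be a countable union of sets of measure [0]. *)
Lemma period_ex x m : diag_periodic x -> orbit_measure x m -> exists2 Q, (0 < Q)%N & period Q x.
Proof.
move=> cx mx; apply: contrapT => noper.
pose A (i : int) : set (borel F) := uorb (tor (Ymon F i) x).
have mA i : measurable (A i) by apply: compact_measurable_borel; exact: uorb_compact.
have Aeq i : m (A i) = m (A 0).
  rewrite -[RHS](orbit_measure_tor mx (Ymon_neq0 F (- i)))//; congr (m _).
  rewrite tor_preimage ?Ymon_neq0// YmonV opprK /A /uorb image_comp.
  apply: eq_imagel => u /= uu; have u0 := lunit_neq0 uu.
  by rewrite Ymon0 tor1 !torM ?Ymon_neq0// mulrC.
have tA : trivIset setT (fun n : nat => A n%:Z).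
  suff H (i j : nat) z : (i < j)%N -> A i%:Z z -> A j%:Z z -> False.
    apply/trivIsetP => i j _ _; rewrite neq_ltn => ij; apply/seteqP; split=> // z [Ai Aj].
    by case/orP: ij => ij; [exact: H ij Ai Aj|exact: H ij Aj Ai].
  move=> ij [u /= uu <-] [v /= uv vE]; apply: noper; exists (j - i)%N; first by rewrite subn_gt0.
  have u0 := lunit_neq0 uu; have v0 := lunit_neq0 uv; have Y0 := Ymon_neq0 F.
  exists (u^-1 * v); first exact: lunitM (lunitV uu) uv.
  move: vE => /(congr1 (tor (u^-1 * Ymon F (- i%:Z)))).
  rewrite !torM ?mulf_neq0 ?invr_neq0//.
  rewrite (_ : u^-1 * Ymon F (- i%:Z) * u * Ymon F i%:Z = 1) ?tor1 => [vE|].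
    rewrite -[RHS]vE; congr tor; rewrite -subzn 1?ltnW// YmonD; ring.
  by rewrite (mulrAC u^-1) mulVf// mul1r -YmonD addNr Ymon0.
have A0 : m (A 0) = 0%E by apply: (equal_disjoint_null (A := fun n : nat => A n%:Z)).
have An (i : int) : m.-negligible (A i) by apply/negligibleP => //; exact: (etrans (Aeq i) A0).
have : m.-negligible (diag_orbit x : set (borel F)).
  apply: (@negligibleS _ _ _ _ (\bigcup_n A n%:Z `|` \bigcup_n A (- n%:Z))).
    rewrite diag_orbitE => _ [a /= a0 <-]; have [d] := degreeP a0.
    set u := _ * a => uu ->.
    have Ad : A d (tor (Ymon F d * u) x).
      by exists u => //; rewrite torM ?(lunit_neq0 uu) ?Ymon_neq0// mulrC.
    have [d0|d0] := leP 0 d; [left|right]; exists `|d|%N => //.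
      by rewrite (_ : `|d|%N%:Z = d)//; lia.
    by rewrite (_ : - `|d|%N%:Z = d)//; lia.
  by apply: negligibleU; apply: negligible_bigcup => n; exact: An.
have morb : measurable (diag_orbit x : set (borel F)).
  exact: compact_measurable_borel.
move=> /(measure_negligible morb) m0; have [m1 _] := mx.
have : 1%E = 0%E :> \bar R by rewrite -m1 -[RHS]m0.
by move=> /eqP; rewrite onee_eq0.
Qed.

End PeriodicMeasures.

(** * Comparison of orbit measures *)

Section OrbitAverages.
Variables (F : finFieldType) (R : realType).
Local Notation K := (laurent F).
Implicit Types (x y z : hspace F) (W : set (hspace F)) (a u v : K).
Implicit Types (m : probability (borel F) R).
Variable s : nat.
Local Notation coefs := {ffun 'I_s.+1 -> F}.
Implicit Types f : coefs.

(** The [rep f] with [f ord0 != 0] represent the units modulo the congruence subgroup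
    of level [s]. *)
Definition rep f : K.
Proof.
exists (fun n => if (n <= 0) && (`|n| < s.+1)%N then f (inord `|n|) else 0).
by exists 0 => n n0; rewrite leNgt n0.
Defined.

Definition trunc u : coefs := [ffun k : 'I_s.+1 => u (- k%:Z)].

Lemma repK : cancel rep trunc.
Proof.
move=> f; apply/ffunP => k; rewrite ffunE /= ifT; last by have := ltn_ord k; lia.
by congr (f _); apply: val_inj; rewrite /= inordK; have := ltn_ord k; lia.
Qed.

Lemma rep_bnd f : bnd 0 (rep f).
Proof. by move=> n n0 /=; rewrite leNgt n0. Qed.

Lemma rep_trunc u : bnd 0 u -> bnd (- s.+1%:Z) (rep (trunc u) - u).
Proof.
move=> ub n sn; rewrite lcoefB /=.
have [n0|n0] := leP n 0; last by rewrite ub// subrr.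
rewrite ifT /=; last by lia.
rewrite ffunE inordK; last by lia.
by rewrite (_ : - `|n|%N%:Z = n) ?subrr//; lia.
Qed.

Lemma rep_lunit f : f ord0 != 0 -> lunit (rep f).
Proof.
by move=> f0; split; [exact: rep_bnd|rewrite /= (_ : inord 0 = ord0)//; apply: val_inj; rewrite /= inordK].
Qed.

Lemma invariant_unit W u v z : invariant s W -> lunit u -> lunit v ->
  bnd (- s.+1%:Z) (u - v) -> W (tor u z) <-> W (tor v z).
Proof.
move=> Wi uu uv uvs; have u0 := lunit_neq0 uu; have v0 := lunit_neq0 uv.
have -> : tor u z = tor (u / v) (tor v z).
  by rewrite torM ?mulf_neq0 ?invr_neq0// divfK.
apply: invariantE Wi _ => i j; rewrite !mxE; move: i j.
have E : u / v - 1 = (u - v) / v by rewrite mulrBl divff.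
apply: ord2P; apply: ord2P; rewrite ?subrr//=; try (by rewrite subr0; exact: bnd0).
by rewrite E; apply: bndMW uvs (lunitV uv).1; rewrite addr0.
Qed.

(** Up to a constant factor, the Haar measure of the set of units that send [z] into
    the [s]-invariant set [W]. *)
Definition kappa W z : nat := \sum_(f : coefs | f ord0 != 0) `[< W (tor (rep f) z) >].

Lemma kappa_unit W v z : invariant s W -> lunit v -> kappa W (tor v z) = kappa W z.
Proof.
move=> Wi uv; have v0 := lunit_neq0 uv.
pose h f : coefs := trunc (rep f * v).
have near f : bnd (- s.+1%:Z) (rep (h f) - rep f * v).
  by apply: rep_trunc; apply: bndMW (@rep_bnd f) uv.1.
have hinj : injective h.
  move=> f g fg; rewrite -(repK f) -(repK g); apply/ffunP => k; rewrite !ffunE.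
  apply/eqP; rewrite -subr_eq0 -lcoefB; apply/eqP.
  suff H : bnd (- s.+1%:Z) (rep f - rep g) by apply: H; have := ltn_ord k; lia.
  have -> : rep f - rep g = ((rep (h g) - rep g * v) - (rep (h f) - rep f * v)) * v^-1.
    by rewrite fg; field.
  apply: bndMW (lunitV uv).1; first by rewrite addr0; exact: lexx.
  by apply: bndB; exact: near.
have h0 f : (h f ord0 != 0) = (f ord0 != 0).
  have E := lcoefM_lead (@rep_bnd f) uv.1; rewrite addr0 in E.
  rewrite /h ffunE oppr0 E.
  rewrite mulf_eq0 (negPf uv.2) orbF /= (_ : inord 0 = ord0)//.
  by apply: val_inj; rewrite /= inordK.
rewrite /kappa [RHS](reindex_inj hinj); apply: eq_big => [f|f f0]; first by rewrite h0.
congr nat_of_bool; have uf := rep_lunit f0.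
rewrite torM ?(lunit_neq0 uf)//; apply: asbool_equiv_eq.
apply: iff_sym; apply: invariant_unit (near f) => //; last exact: lunitM.
by apply: rep_lunit; rewrite h0.
Qed.

Definition Phi (Q : nat) W z : nat := \sum_(i < Q) kappa W (tor (Ymon F i%:Z) z).

Lemma kappa_period Q W z : invariant s W -> period Q z ->
  kappa W (tor (Ymon F Q%:Z) z) = kappa W z.
Proof.
move=> Wi [u uu uz]; rewrite -[in RHS]uz mulrC -torM ?Ymon_neq0 ?(lunit_neq0 uu)//.
by rewrite (kappa_unit _ Wi uu).
Qed.

Lemma Phi_shift Q W z : invariant s W -> period Q z ->
  Phi Q W (tor (Ymon F 1) z) = Phi Q W z.
Proof.
move=> Wi pz; apply: (@addnI (kappa W z)).
have : (\sum_(i < Q.+1) kappa W (tor (Ymon F i%:Z) z) = kappa W z + Phi Q W z)%N.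
  by rewrite big_ord_recr /= kappa_period// addnC.
rewrite big_ord_recl /= Ymon0 tor1 => <-; congr (_ + _)%N.
apply: eq_bigr => i _; rewrite torM ?Ymon_neq0// -YmonD.
by congr (kappa _ (tor (Ymon F _) _)); rewrite /bump; lia.
Qed.

Lemma Phi_orbit Q W z a : invariant s W -> period Q z -> a != 0 ->
  Phi Q W (tor a z) = Phi Q W z.
Proof.
move=> Wi pz a0; have shift (n : nat) w : period Q w -> Phi Q W (tor (Ymon F n%:Z) w) = Phi Q W w.
  move=> pw; elim: n => [|n <-]; first by rewrite Ymon0 tor1.
  rewrite -[RHS]Phi_shift//; last by apply: period_orbit => //; exact: Ymon_neq0.
  by rewrite torM ?Ymon_neq0// -YmonD; congr (Phi _ _ (tor (Ymon F _) _)); lia.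
have shiftZ d : Phi Q W (tor (Ymon F d) z) = Phi Q W z.
  have [d0|d0] := leP 0 d.
    by rewrite (_ : d = `|d|%N%:Z) ?shift//; lia.
  rewrite -[LHS](shift `|d|%N); last by apply: period_orbit => //; exact: Ymon_neq0.
  rewrite torM ?Ymon_neq0// -YmonD (_ : `|d|%N%:Z + d = 0) ?Ymon0 ?tor1//; lia.
have [d] := degreeP a0; set u := _ * a => uu ->.
have u0 := lunit_neq0 uu.
rewrite -[RHS](shiftZ d); apply: eq_bigr => i _.
rewrite !torM ?mulf_neq0 ?Ymon_neq0//.
rewrite (_ : _ * (_ * u) = u * (Ymon F i%:Z * Ymon F d)); last by ring.
by rewrite -(torM _ u0) ?mulf_neq0 ?Ymon_neq0// kappa_unit.
Qed.

Definition nrep : nat := #|[pred f : coefs | f ord0 != 0]|.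

Lemma nrep_gt0 : (0 < nrep)%N.
Proof.
by apply/card_gt0P; exists [ffun=> 1]; rewrite inE ffunE oner_neq0.
Qed.

(** The sum [Phi Q W] is constant on the orbit, and its integral over the orbit is a
    sum of measures of translates of [W], which are all equal. *)
Lemma orbit_average Q W y m : invariant s W -> diag_periodic y ->
  orbit_measure y m -> period Q y ->
  (m W *+ (Q * nrep) = (Phi Q W y)%:R%:E)%E.
Proof.
move=> Wi cy my py.
have mW : measurable (W : set (borel F)).
  by apply: open_measurable_borel; exact: invariant_open Wi.
pose P (p : 'I_Q * coefs) := p.2 ord0 != 0.
pose c (p : 'I_Q * coefs) : K := if P p then Ymon F p.1%:Z * rep p.2 else 1.
have c0 p : c p != 0.
  rewrite /c; case: ifPn => [Pp|_]; last exact: oner_neq0.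
  by rewrite Ymon_unit_neq0//; exact: rep_lunit.
have mA a : a != 0 -> measurable (tor a @^-1` W : set (borel F)).
  move=> a0; apply: open_measurable_borel.
  apply: open_comp; last exact: invariant_open Wi.
  by move=> z _; apply: mact_continuous; exact: dg_invertible.
have := @finite_average _ (borel F) R m (diag_orbit y) _ (enum P)
  (fun p => tor (c p) @^-1` W) (m W) (Phi Q W y).
rewrite -cardE (_ : #|P| = (Q * nrep)%N); last first.
  rewrite -sum1_card -(pair_big_dep xpredT (fun _ f => f ord0 != 0) (fun _ _ => 1%N)) /=.
  by rewrite sum_nat_const card_ord sum1_card.
apply.
- exact: compact_measurable_borel.
- by case: my.
- by move=> p; exact: mA.
- by move=> p; exact: orbit_measure_tor my (c0 p) mW.
rewrite diag_orbitE => _ [a /= a0 <-]; rewrite -[RHS](Phi_orbit Wi py a0).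
rewrite big_enum -(pair_big_dep xpredT (fun _ f => f ord0 != 0)
  (fun i f => nat_of_bool `[< W (tor (c (i, f)) (tor a y)) >])) /=.
apply: eq_bigr => i _; apply: eq_bigr => f f0; rewrite /c /P /= f0.
by rewrite mulrC -torM ?Ymon_neq0//; apply: lunit_neq0; exact: rep_lunit.
Qed.

Lemma Phi_mul P t W z : invariant s W -> period P z ->
  \sum_(i < t * P) kappa W (tor (Ymon F i%:Z) z) = (t * Phi P W z)%N.
Proof.
move=> Wi pz; elim: t => [|t IH]; first by rewrite mul0n big_ord0.
rewrite mulSn addnC big_split_ord /= IH mulSn addnC; congr (_ + _)%N.
rewrite -[RHS](Phi_orbit Wi pz (Ymon_neq0 F (t * P)%N%:Z)).
apply: eq_bigr => i _; rewrite torM ?Ymon_neq0// -YmonD.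
by congr (kappa _ (tor (Ymon F _) _)); lia.
Qed.

(** Conjugation by [dg a] multiplies one off-diagonal entry by [a] and the other
    one by its inverse: precision is lost at most at speed one. *)
Lemma near1_dg_conj T (i : nat) u : (i <= T)%N -> lunit u -> forall A : 'M[K]_2,
  near1 (s + T) A ->
  near1 s (dg (Ymon F i%:Z * u) *m A *m dg (Ymon F i%:Z * u)^-1).
Proof.
move=> iT uu A As; set a := Ymon F _ * u.
have a0 : a != 0 by exact: Ymon_unit_neq0.
have ab : bnd i%:Z a by apply: bndMW (@Ymon_bnd _ _) uu.1; rewrite addr0.
have avb : bnd 0 a^-1.
  rewrite invfM YmonV; apply: bndMW (@Ymon_bnd _ _) (lunitV uu).1; lia.
have e i j := As i j.
have e00 := e 0 0; have e01 := e 0 1; have e10 := e 1 0; have e11 := e 1 1.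
rewrite !mxE /= ?subr0 in e00 e01 e10 e11.
rewrite (mk2_eta A) /dg !mk2M !(mulr0, mul0r, mulr1, mul1r, addr0, add0r).
rewrite /near1 -mk2_1 => k l; rewrite mxE [X in _ + X]mxE; move: k l.
apply: ord2P; apply: ord2P; rewrite !mk2E.
- by rewrite mulrAC divff// mul1r; apply: bndW e00; lia.
- by rewrite subr0; apply: bndMW ab e01; lia.
- by rewrite subr0; apply: bndMW e10 avb; lia.
- by apply: bndW e11; lia.
Qed.

Lemma kappa_near T (i : nat) W A z : (i <= T)%N -> invariant s W -> near1 (s + T) A ->
  kappa W (tor (Ymon F i%:Z) (mact A z)) = kappa W (tor (Ymon F i%:Z) z).
Proof.
move=> iT Wi As; apply: eq_bigr => f f0; congr nat_of_bool.
have uf := rep_lunit f0; have iA := near1_unit As.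
rewrite !torM ?Ymon_neq0 ?(lunit_neq0 uf)// mulrC; set a := _ * _.
have a0 : a != 0 by exact: Ymon_unit_neq0.
have ia := dg_invertible a0; have iaV : invertible (dg a^-1) by apply: dg_invertible; rewrite invr_neq0.
apply: asbool_equiv_eq.
have -> : tor a (mact A z) = mact (dg a *m A *m dg a^-1) (tor a z).
  rewrite /tor (mactM _ ia iA) (mactM _ (invertibleM (invertibleM ia iA) iaV) ia).
  have -> : dg a *m A *m dg a^-1 *m dg a = dg a *m A; last by [].
  by rewrite -mulmxA dgM (mulVf a0) dg1 mulmx1; reflexivity.
by apply: invariantE Wi _; exact: near1_dg_conj iT uf _ As.
Qed.

(** As [y] agrees with a point of the orbit of [x] to precision [s + T], the two
    orbits agree to precision [s] during a time [T]. In this time, the orbit of [x]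
    runs through at least [t] periods, and that of [y] through at most one. *)
Lemma shadow_measure x y mx my P Q T t a A W : (0 < P)%N -> (0 < Q)%N ->
  diag_periodic x -> diag_periodic y ->
  orbit_measure x mx -> orbit_measure y my -> period P x -> period Q y ->
  invariant s W -> a != 0 -> near1 (s + T) A -> y = mact A (tor a x) ->
  (t * P <= T)%N -> (T <= Q)%N ->
  (((t * P)%:R / Q%:R : R)%:E * mx W <= my W)%E.
Proof.
move=> P0 Q0 cx cy ox oy px py Wi a0 As yE tPT TQ.
have mW : measurable (W : set (borel F)).
  by apply: open_measurable_borel; exact: invariant_open Wi.
have px' := period_orbit a0 px.
have le : (t * Phi P W x <= Phi Q W y)%N.
  rewrite -(Phi_orbit Wi px a0) -Phi_mul// -[Q in Phi Q](subnKC (leq_trans tPT TQ)).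
  rewrite /Phi big_split_ord /= (leq_trans _ (leq_addr _ _))//.
  apply: leq_sum => i _; rewrite yE (kappa_near _ _ Wi As)//.
  by apply: leq_trans tPT; exact: ltnW.
have := orbit_average Wi cx ox px; have := orbit_average Wi cy oy py.
have fx : mx W \is a fin_num by exact: fin_num_measure.
have fy : my W \is a fin_num by exact: fin_num_measure.
rewrite -(fineK fx) -(fineK fy) -!EFin_natmul => -[Ey] [Ex].
rewrite -EFinM lee_fin; have n0 := nrep_gt0.
rewrite -(@ler_pM2r _ (Q * nrep)%:R) ?ltr0n ?muln_gt0 ?Q0//.
rewrite [leRHS]mulr_natr Ey.
have -> : (t * P)%:R / Q%:R * fine (mx W) * (Q * nrep)%:R = t%:R * (fine (mx W) *+ (P * nrep)).
  rewrite -mulr_natr !natrM; field.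
  by rewrite pnatr_eq0 -lt0n.
by rewrite Ex -natrM ler_nat.
Qed.

End OrbitAverages.

(** * Approximation of lattices in the Hecke tree *)

Section PrimeApproximation.
Variables (F : finFieldType) (nu : {poly F}).
Hypothesis nu_prime : irreducible_poly nu.
Local Notation K := (laurent F).
Local Notation N := (laurent_poly nu : K).
Implicit Types (g h A : 'M[K]_2) (t a : K) (W Z : 'M[{poly F}]_2).

Lemma nu_neq0 : nu != 0.
Proof. exact: irredp_neq0. Qed.

Lemma N_neq0 : N != 0.
Proof. by rewrite lpoly_eq0 nu_neq0. Qed.

Lemma bnd_NVX j : bnd (- j%:Z) (N ^- j).
Proof.
have NV : bnd (-1) N^-1.
  have [Nb Nl] := lpoly_degree nu_neq0; have [NVb _] := bnd_inv Nb Nl.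
  by apply: bndW NVb; case: nu_prime => + _; case: (size nu) => [|[|]]//=; lia.
elim: j => [|j IH]; first by rewrite expr0 invr1; exact: (lunit1 F).1.
by rewrite exprSr invfM; apply: bndMW IH NV; lia.
Qed.

(** Round [t nu^j] to a polynomial, and add [1] to it if [nu] divides it. *)
Lemma approx_coprime t j : exists r : {poly F},
  ~~ (nu %| r) /\ bnd (- j%:Z) (laurent_poly r / N ^+ j - t).
Proof.
have N0 : N ^+ j != 0 by rewrite expf_neq0// N_neq0.
pose r0 := polypart (t * N ^+ j).
have close (r : {poly F}) : bnd 0 (laurent_poly (r - r0)) ->
    bnd (- j%:Z) (laurent_poly r / N ^+ j - t).
  move=> rb; have -> : laurent_poly r / N ^+ j - t =
      (laurent_poly (r - r0) - (t * N ^+ j - laurent_poly r0)) * N ^- j.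
    by rewrite rmorphB /=; field.
  apply: (@bndMW _ 0 (- j%:Z)); [by rewrite add0r| |exact: bnd_NVX].
  by apply: bndB => //; apply: bndW (polypartP _).
have [r0nu|r0nu] := boolP (nu %| r0); last first.
  by exists r0; split=> //; apply: close; rewrite subrr rmorph0; exact: bnd0.
exists (r0 + 1); split; last first.
  by apply: close; rewrite addrAC subrr add0r rmorph1; exact: (lunit1 F).1.
rewrite dvdp_addr// dvdp1; case: nu_prime => + _; by case: (size nu) => [|[|]].
Qed.

(** As the lower left entry is prime to the determinant, the last row of [W] is
    unimodular and completes to an integral matrix of determinant [1]. *)
Lemma hermite_form W (D e f : {poly F}) : \det W = D -> f * D + e * W 1 0 = 1 ->
  exists2 Z, Z \in unitmx & W = mk2 D (W 0 0 * e) 0 1 *m Z.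
Proof.
rewrite det2 => detW fe.
exists (mk2 (W 0 0 * f) (W 0 1 * f - e) (W 1 0) (W 1 1)).
  rewrite mk2_unit (_ : _ - _ = 1) ?unitr1// -fe -detW; ring.
rewrite mk2M; apply: mx2P; rewrite mk2E.
- rewrite -[LHS]mulr1 -fe; ring.
- rewrite -[LHS]mulr1 -fe -detW; ring.
- by rewrite mul0r mul1r add0r.
- by rewrite mul0r mul1r add0r.
Qed.

Definition lowu t : 'M[K]_2 := mk2 1 0 t 1.
Definition upu t : 'M[K]_2 := mk2 1 t 0 1.

Lemma lowu_bnd (c : nat) t : bnd c%:Z t -> mbnd c%:Z (lowu t).
Proof.
by move=> tc; apply: mk2_mbnd => //; apply: bndW (lunit1 F).1; lia.
Qed.

Lemma upu_bnd (c : nat) t : bnd c%:Z t -> mbnd c%:Z (upu t).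
Proof.
by move=> tc; apply: mk2_mbnd => //; apply: bndW (lunit1 F).1; lia.
Qed.

Lemma lowuB t t' : lowu t - lowu t' = mk2 0 0 (t - t') 0.
Proof. by apply: mx2P; rewrite !mxE /= ?subrr. Qed.

Lemma upuB t t' : upu t - upu t' = mk2 0 (t - t') 0 0.
Proof. by apply: mx2P; rewrite !mxE /= ?subrr. Qed.

Lemma unipotent_decomposition A : \det A = 1 -> A 0 1 != 0 ->
  exists t1 t2 t3, A = lowu t1 *m upu t2 *m lowu t3.
Proof.
move=> detA b0; have [a [b [c [d AE]]]] : exists a b c d : K, A = mk2 a b c d.
  by exists (A 0 0), (A 0 1), (A 1 0), (A 1 1); exact: mk2_eta.
move: detA b0; rewrite AE mk2_det !mk2E => detA b0.
have cE : c = (a * d - 1) / b by apply: (canRL (mulfK b0)); rewrite -detA; ring.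
exists ((d - 1) / b), b, ((a - 1) / b).
by rewrite /lowu /upu !mk2M cE; congr mk2; field.
Qed.

Lemma bnd_nat (x : K) : exists c : nat, bnd c%:Z x.
Proof. by have [d xd] := bnd_ex x; exists `|d|%N; apply: bndW xd; lia. Qed.

Lemma unipotent_perturb (c j : nat) t1 t2 t3 t1' t2' t3' :
  bnd c%:Z t1 -> bnd c%:Z t2 -> bnd c%:Z t3 ->
  bnd (- j%:Z) (t1' - t1) -> bnd (- j%:Z) (t2' - t2) -> bnd (- j%:Z) (t3' - t3) ->
  mbnd (c%:Z + c%:Z - j%:Z)
    (lowu t1' *m upu t2' *m lowu t3' - lowu t1 *m upu t2 *m lowu t3).
Proof.
move=> c1 c2 c3 e1 e2 e3.
have bnd' t t' : bnd c%:Z t -> bnd (- j%:Z) (t' - t) -> bnd c%:Z t'.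
  by move=> tc e; rewrite -(subrK t t'); apply: bndD => //; apply: bndW e; lia.
have c1' := bnd' _ _ c1 e1; have c2' := bnd' _ _ c2 e2; have c3' := bnd' _ _ c3 e3.
rewrite mulmx3B.
have d1 : mbnd (- j%:Z) (lowu t1' - lowu t1) by rewrite lowuB; apply: mk2_mbnd.
have d2 : mbnd (- j%:Z) (upu t2' - upu t2) by rewrite upuB; apply: mk2_mbnd.
have d3 : mbnd (- j%:Z) (lowu t3' - lowu t3) by rewrite lowuB; apply: mk2_mbnd.
apply: mbndD; first apply: mbndD.
- apply: mbndMW (mbndM d1 (upu_bnd c2')) (lowu_bnd c3'); lia.
- apply: mbndMW (mbndM (lowu_bnd c1) d2) (lowu_bnd c3'); lia.
- apply: mbndMW (mbndM (lowu_bnd c1) (upu_bnd c2)) d3; lia.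
Qed.

(** The determinant is adjusted by the diagonal group, and the upper right entry by a
    change of the basis of the second lattice; the resulting matrix is a product of
    three unipotent matrices. *)
Lemma class_normalize g h : invertible g -> invertible h ->
  exists a h', [/\ a != 0, invertible h', cls h' = cls h,
    \det (minv g *m dg a *m h') = 1 & (minv g *m dg a *m h') 0 1 != 0].
Proof.
move=> ig ih.
have dg0 := (invertible_det g).1 ig; have dh0 := (invertible_det h).1 ih.
pose a := \det g / \det h; exists a.
have nz (x y : K) : x != 0 -> y != 0 -> x / y != 0.
  by move=> ? ?; rewrite mulf_neq0 ?invr_neq0.
have a0 : a != 0 by exact: (nz _ _ dg0 dh0).
have alg (x y z : K) : z != 0 -> x * y = 1 -> x * (y / z) * z = 1.
  by move=> z0 xy; rewrite mulrA xy mul1r mulVf.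
have detV : \det (minv g) * \det g = 1 by rewrite -Kdet_mul (mulVI ig) (@det1 K).
have det_dg (t : K) : \det (dg t) = t by rewrite /dg mk2_det mulr1 mulr0 subr0.
have detE h' : \det h' = \det h -> \det (minv g *m dg a *m h') = 1.
  by move=> hE; rewrite Kdet_mul Kdet_mul hE det_dg; exact: (alg _ _ _ dh0 detV).
have [b0|b0] := eqVneq ((minv g *m dg a *m h) 0 1) 0; last first.
  by exists h; split=> //; exact: detE.
have uZ : mk2 (1 : {poly F}) 1 0 1 \in unitmx by rewrite mk2_unit mulr1 mulr0 subr0 unitr1.
exists (h *m lmap (mk2 1 1 0 1)); split=> //.
- by apply: invertibleM => //; exact: lmap_unitmx.
- exact: cls_mulr.
- by apply: detE; rewrite Kdet_mul det_map_mx mk2_det mulr1 mulr0 subr0 rmorph1 mulr1.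
rewrite mulmxA; have := detE h erefl; set A := _ *m h in b0 *.
rewrite det2 b0 mul0r subr0 => d1.
rewrite mulmx2E lmap_mk2 !mk2E !rmorph1 !mulr1 b0 addr0.
by apply: contra_eq_neq d1 => ->; rewrite mul0r eq_sym oner_neq0.
Qed.

Lemma lmap_unipotent_product j (r1 r2 r3 : {poly F}) :
  lmap (mk2 (nu ^+ j) 0 r1 (nu ^+ j) *m mk2 (nu ^+ j) r2 0 (nu ^+ j) *m
        mk2 (nu ^+ j) 0 r3 (nu ^+ j)) =
  N ^+ (3 * j) *: (lowu (laurent_poly r1 / N ^+ j) *m
    upu (laurent_poly r2 / N ^+ j) *m lowu (laurent_poly r3 / N ^+ j)).
Proof.
have N0 : N ^+ j != 0 by exact/expf_neq0/N_neq0.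
have scaled (c : K) x : c != 0 -> c *: lowu (x / c) = mk2 c 0 x c /\
    c *: upu (x / c) = mk2 c x 0 c.
  by move=> c0; split; apply: mx2P; rewrite !mxE /= ?mulr0 ?mulr1// mulrC divfK.
rewrite !lmapM !lmap_mk2 rmorph0 rmorphXn /=.
rewrite -(scaled _ _ N0).1 -(scaled _ _ N0).2 -(scaled _ _ N0).1.
by rewrite Kscale3 -exprM mulnC; reflexivity.
Qed.

(** Modulo [nu], the lower left entry of the product is [r1 r2 r3]. *)
Lemma unipotent_product_hermite j (r1 r2 r3 : {poly F}) : (0 < j)%N ->
  ~~ (nu %| r1) -> ~~ (nu %| r2) -> ~~ (nu %| r3) ->
  exists b Z, Z \in unitmx /\
    mk2 (nu ^+ j) 0 r1 (nu ^+ j) *m mk2 (nu ^+ j) r2 0 (nu ^+ j) *m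
      mk2 (nu ^+ j) 0 r3 (nu ^+ j) = mk2 (nu ^+ (6 * j)) b 0 1 *m Z.
Proof.
move=> j0 r1nu r2nu r3nu; set n := nu ^+ j; set W := _ *m mk2 n 0 r3 n.
have detW : \det W = nu ^+ (6 * j).
  rewrite /W !det_mulmx !mk2_det !(mul0r, mulr0, subr0).
  by rewrite /n -!exprD; congr (_ ^+ _); lia.
have W10 : W 1 0 = n * (n * (r1 + r3)) + r1 * r2 * r3.
  by rewrite /W !mk2M mk2E; ring.
have cop : coprimep (nu ^+ (6 * j)) (W 1 0).
  have irr := irreducible_poly_coprime _ nu_prime.
  apply/coprimep_expl; rewrite irr W10.
  rewrite dvdp_addr; last by rewrite /n -(prednK j0) exprS -!mulrA dvdp_mulr.
  by rewrite -irr !coprimepMr !irr r1nu r2nu r3nu.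
have /Bezout_eq1_coprimepP[[f e] /= fe] := cop.
by have [Z uZ WE] := hermite_form detW fe; exists (W 0 0 * e), Z.
Qed.

Lemma cls_quotient g h A M a : invertible g -> invertible h -> invertible A ->
  invertible M -> a != 0 -> g *m M = dg a *m h ->
  cls (g *m A) = mact (g *m (A *m minv M) *m minv g) (tor a (cls h)).
Proof.
move=> ig ih iA iM a0 gM.
have iV := invertibleV iM; have igV := invertibleV ig.
have iAM := invertibleM iA iV; have iq := invertibleM (invertibleM ig iAM) igV.
rewrite /tor (mact_cls (dg_invertible a0) ih) -gM (mact_cls iq (invertibleM ig iM)).
rewrite mulmxA (mulKVI _ ig) -mulmxA (mulKVI _ iM); reflexivity.
Qed.

(** An effective form of the density of the Hecke tree: the three unipotent factors of
    the matrix that sends one class to the other are approximated by unipotent matrices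
    over [F[Y][1/nu]]. The numerators being prime to [nu], the product of the
    approximations is a primitive integral matrix of determinant [nu^(6 j)], up to a
    scalar, and its Hermite form is a point at distance [6 j] of the tree. The precision
    is proportional to this distance. *)
Lemma hecke_approx g h : invertible g -> invertible h ->
  exists C : nat, forall s j, (s + C <= j)%N ->
  exists b : {poly F}, exists a A, [/\ a != 0, near1 s A &
    cls (g *m lmap (mk2 (nu ^+ (6 * j)) b 0 1)) = mact A (tor a (cls h))].
Proof.
move=> ig ih; have [a [h' [a0 ih' ih'E detM M01]]] := class_normalize ig ih.
have gM : g *m (minv g *m dg a *m h') = dg a *m h' by rewrite -mulmxA (mulVIK ig).
move: (minv g *m dg a *m h') detM M01 gM => M detM M01 gM.
have iM : invertible M by apply/invertible_det; rewrite detM oner_neq0.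
have [t1 [t2 [t3 ME]]] := unipotent_decomposition detM M01.
have [c1 t1c] := bnd_nat t1; have [c2 t2c] := bnd_nat t2; have [c3 t3c] := bnd_nat t3.
pose c := (c1 + c2 + c3)%N.
have {}t1c : bnd c%:Z t1 by apply: bndW t1c; lia.
have {}t2c : bnd c%:Z t2 by apply: bndW t2c; lia.
have {}t3c : bnd c%:Z t3 by apply: bndW t3c; lia.
have [C0 C0P] := near1_quot iM; have [C1 C1P] := near1_conj ig.
exists (C0 + C1 + 2 * c).+1 => s j sj.
have [r1 [r1nu r1t]] := approx_coprime t1 j.
have [r2 [r2nu r2t]] := approx_coprime t2 j.
have [r3 [r3nu r3t]] := approx_coprime t3 j.
have [|b [Z [uZ WE]]] := @unipotent_product_hermite j r1 r2 r3 _ r1nu r2nu r3nu.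
  by lia.
have lW := lmap_unipotent_product j r1 r2 r3.
have := unipotent_perturb t1c t2c t3c r1t r2t r3t; rewrite -ME.
move: (lowu _ *m upu _ *m lowu _) lW => G lW near {ME r1t r2t r3t}.
have {}near : mbnd (- (s + C1 + C0)%N%:Z) (G - M) by apply: mbndW near; lia.
have GM := C0P _ _ near; have gGM := C1P _ _ GM.
have iG : invertible G.
  by rewrite -(mulKVI G iM); exact: invertibleM (near1_unit GM) iM.
exists b, a, (g *m (G *m minv M) *m minv g); split=> //.
rewrite -ih'E -(cls_quotient ig ih' iG iM a0 gM).
have iD : invertible (lmap (mk2 (nu ^+ (6 * j)) b 0 1)).
  by apply: lmap_unit; rewrite mk2_det mulr1 mulr0 subr0; exact/expf_neq0/nu_neq0.
rewrite -(cls_mulr (invertibleM ig iD) uZ) -mulmxA -lmapM -WE lW KscaleAr.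
by rewrite (cls_scale (invertibleM ig iG)); [reflexivity|exact/expf_neq0/N_neq0].
Qed.

End PrimeApproximation.

(** * Rays of the Hecke tree *)

Section HeckeRay.
Variables (F : finFieldType) (nu : {poly F}).
Hypothesis nu_prime : irreducible_poly nu.
Local Notation K := (laurent F).
Local Notation N := (laurent_poly nu : K).
Implicit Types (A B M g : 'M[K]_2) (Z T : 'M[{poly F}]_2) (x y : hspace F).

Lemma hecke_step_cls M (c : {poly F}) : invertible M ->
  hecke_step nu (cls M) (cls (M *m lmap (mk2 nu c 0 1))).
Proof.
move=> iM; set P := mk2 nu c 0 1.
have iP : invertible (lmap P).
  by apply: lmap_unit; rewrite mk2_det mulr1 mulr0 subr0; exact: nu_neq0.
have lM := lat_refl iM; have lMP := lat_refl (invertibleM iM iP).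
exists (lat M), (lat (M *m lmap P)); split=> //; first exact: lat_mul_sub.
have [f fE] : exists f : 'cV[K]_2 -> {poly F},
    forall r, f (M *m lmap r) = r 0 0 - c * r 1 0.
  exists (fun u => polypart ((minv M *m u) 0 0) - c * polypart ((minv M *m u) 1 0)) => r.
  by rewrite (mulIK iM) !mxE !polypartK.
have PE (r : 'cV[{poly F}]_2) : (P *m r) 0 0 = nu * r 0 0 + c * r 1 0 /\ (P *m r) 1 0 = r 1 0.
  by rewrite !mulcv2E !mk2E mul0r mul1r add0r.
exists f; split.
- move=> p _ _ [r _ <-] [r' _ <-].
  have [w [<- wE]] : exists w : 'cV[{poly F}]_2,
      M *m lmap w = laurent_poly p *: (M *m lmap r) + M *m lmap r' /\
      forall i, w i 0 = p * r i 0 + r' i 0.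
    exists (\col_i (p * r i 0 + r' i 0)); split=> [|i]; last by rewrite mxE.
    rewrite -KscaleAr -mulmxDr; congr (_ *m _).
    by apply/matrixP => i j; rewrite !mxE rmorphD rmorphM (ord1 j).
  have aux X X1 X2 : X = w 0 0 - c * w 1 0 -> X1 = r 0 0 - c * r 1 0 ->
      X2 = r' 0 0 - c * r' 1 0 -> nu %| X - (p * X1 + X2).
    move=> -> -> ->; rewrite !wE.
    by rewrite (_ : _ - _ - _ = 0) ?dvdp0//; ring.
  exact: aux (fE w) (fE r) (fE r').
- move=> r; exists (M *m lmap (\col_i if i == 0 then r else 0)).
    by exists (\col_i if i == 0 then r else 0).
  by rewrite fE !mxE /= mulr0 subr0 subrr dvdp0.
move=> _ [r _ <-]; rewrite fE; split.
  move=> /dvdpP[q rq]; exists (\col_i if i == 0 then q else r 1 0) => //.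
  rewrite -mulmxA -lmapM; congr (_ *m lmap _).
  apply/matrixP => i j; rewrite (ord1 j); move: i; apply: ord2P.
    by rewrite (PE _).1 !mxE /= mulrC -rq subrK.
  by rewrite (PE _).2 !mxE.
move=> [r' _]; rewrite -mulmxA -lmapM => /(can_inj (mulIK iM))/lmap_inj rE.
by rewrite -rE (PE _).1 (PE _).2 addrK dvdp_mulr.
Qed.

Lemma quotient_iso_mul L L' : quotient_iso nu L L' -> (L 0) ->
  (forall u, L u -> L (N *: u)) -> forall u, L u -> L' (N *: u).
Proof.
move=> [f [flin _ fker]] L0 LN u Lu; apply/(fker _ (LN _ Lu)).1.
have nuf0 : nu %| f 0.
  have := flin 1 0 0 L0 L0; rewrite scaler0 addr0 mul1r opprD addrA subrr sub0r.
  by rewrite dvdpNr.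
have := flin nu u 0 Lu L0; rewrite addr0 => H.
have -> : f (N *: u) = (f (N *: u) - (nu * f u + f 0)) + (nu * f u + f 0) by rewrite subrK.
by apply: dvdp_add => //; apply: dvdp_add => //; exact: dvdp_mulr.
Qed.

Lemma lat_mul_poly A (p : {poly F}) u : lat A u -> lat A (laurent_poly p *: u).
Proof.
move=> [r _ <-]; exists (p *: r) => //; rewrite -KscaleAr; congr (_ *m _).
by apply/matrixP => i j; rewrite !mxE rmorphM.
Qed.

Lemma lat0 A : lat A 0.
Proof.
exists 0 => //; rewrite (_ : lmap 0 = 0); first by rewrite (@mulmx0 K).
by apply/matrixP => i j; rewrite !mxE rmorph0.
Qed.

Lemma hecke_step_mx x y A B : hecke_step nu x y ->
  x = cls A -> invertible A -> y = cls B -> invertible B ->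
  exists e Z Z', [/\ e != 0, e *: B = A *m lmap Z & N *: A = (e *: B) *m lmap Z'].
Proof.
move=> [L [L' [xL yL L'L qi]]] xE iA yE iB; move: xL yL; rewrite xE yE.
move=> /(cls_rep iA)[c c0 LE] /(cls_rep iB)[d d0 L'E].
rewrite LE L'E in L'L qi; have [Z ZE] := lat_sub L'L.
have : lat (N *: (c *: A)) `<=` lat (d *: B).
  rewrite -lat_scale => _ [u Lu <-]; apply: quotient_iso_mul qi _ _ _ Lu.
    exact: lat0.
  by move=> v; exact: lat_mul_poly.
move=> /lat_sub[Z' Z'E]; exists (c^-1 * d), Z, Z'; split.
- by rewrite mulf_neq0 ?invr_neq0.
- by rewrite -KscaleA ZE -KscaleAl KscaleA (mulVf c0) Kscale1; reflexivity.
by rewrite -KscaleA KscaleAl -Z'E KscaleA KscaleA mulrAC (mulVf c0) mul1r; reflexivity.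
Qed.

(** A walk of length [k] in the Hecke graph, whatever the directions of its steps, moves a
    basis by an integral matrix that divides [nu ^ k]; this bounds distances from
    below. *)
Definition divides_pow (k : nat) M M' := exists Z Z',
  M' = M *m lmap Z /\ N ^+ k *: M = M' *m lmap Z'.

Lemma hecke_edge_mx x y M : hecke_edge nu x y -> x = cls M -> invertible M ->
  exists M', [/\ invertible M', y = cls M' & divides_pow 1 M M'].
Proof.
move=> exy xE iM; have [B iB yE] := cls_ex y; have N0 := N_neq0 nu_prime.
case: exy => [st|st].
  have [e [Z [Z' [e0 e1 e2]]]] := hecke_step_mx st xE iM yE iB.
  exists (e *: B); split; [exact: invertibleZ|by rewrite cls_scale|].
  by exists Z, Z'; split; [exact: e1|rewrite expr1; exact: e2].
have [e [Z [Z' [e0 e1 e2]]]] := hecke_step_mx st yE iB xE iM.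
have Ne : N * e^-1 != 0 by rewrite mulf_neq0 ?invr_neq0.
exists ((N * e^-1) *: B); split; [exact: invertibleZ|by rewrite cls_scale|].
exists Z', Z; split.
  by rewrite mulrC -KscaleA e2 KscaleAl KscaleA (mulVf e0) Kscale1; reflexivity.
by rewrite KscaleAl -e1 KscaleA -mulrA (mulVf e0) mulr1 expr1; reflexivity.
Qed.

Lemma hecke_walk_mx k x y M : walk (hecke_edge nu) k x y -> x = cls M -> invertible M ->
  exists M', [/\ invertible M', y = cls M' & divides_pow k M M'].
Proof.
move=> w; elim: w M => [{}x|{}k {}x z {}y exz _ IH] M xE iM.
  exists M; split=> //; exists 1%:M, 1%:M.
  by split; [|rewrite expr0 Kscale1]; rewrite lmap1 mulmx1; reflexivity.
have [M1 [iM1 zE [Z1 [Z1' [E1 E1']]]]] := hecke_edge_mx exz xE iM.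
have [M' [iM' yE [Z [Z' [E E']]]]] := IH M1 zE iM1.
exists M'; split=> //; exists (Z1 *m Z), (Z' *m Z1'); split.
  by rewrite lmapM mulmxA -E1; exact: E.
by rewrite lmapM mulmxA -E' KscaleAl -E1' expr1 KscaleA -exprSr; reflexivity.
Qed.

Variables (g0 : 'M[K]_2) (c : nat -> {poly F}).
Hypothesis ig0 : invertible g0.

(** Rays from [cls g0] are given by the expansions in powers of [nu] of the [nu]-adic
    integers; the digits are not reduced modulo [nu]. *)
Definition digits n : {poly F} := \sum_(i < n) nu ^+ i * c i.
Definition Tm n : 'M[{poly F}]_2 := mk2 (nu ^+ n) (digits n) 0 1.
Definition vertex n : hspace F := cls (g0 *m lmap (Tm n)).

Lemma Tm_invertible n : invertible (lmap (Tm n)).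
Proof.
by apply: lmap_unit; rewrite mk2_det mulr1 mulr0 subr0; exact/expf_neq0/nu_neq0.
Qed.

Lemma TmS n : Tm n.+1 = Tm n *m mk2 nu (c n) 0 1.
Proof.
rewrite /Tm mk2M /digits big_ord_recr /= !(mulr0, mul0r, mulr1, addr0, mul1r, add0r).
by rewrite exprSr addrC.
Qed.

Lemma TmD n k : exists b, Tm (n + k) = Tm n *m mk2 (nu ^+ k) b 0 1.
Proof.
elim: k => [|k [b IH]].
  by exists 0; rewrite addn0 expr0 mk2_1 mulmx1.
exists (nu ^+ k * c (n + k)%N + b); rewrite addnS TmS IH -mulmxA; congr (_ *m _).
by rewrite mk2M !(mulr0, mul0r, mulr1, addr0, mul1r, add0r) exprSr.
Qed.

Lemma vertex0 : vertex 0 = cls g0.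
Proof. by rewrite /vertex /Tm /digits big_ord0 expr0 mk2_1 lmap1 mulmx1. Qed.

Lemma vertex_edge n : hecke_edge nu (vertex n) (vertex n.+1).
Proof.
left; rewrite /vertex TmS lmapM mulmxA; apply: hecke_step_cls.
exact: invertibleM ig0 (Tm_invertible n).
Qed.

(** From the vertex [i] to the vertex [j], a walk of length [k] moves the basis by a
    multiple of an integral matrix with entry [nu ^ (j - i)], because the last row of
    [Tm] is [(0, 1)]; hence [nu ^ (j - i)] divides [nu ^ k]. *)
Lemma vertex_geodesic : geodesic_ray nu vertex.
Proof.
split=> [|i j k w]; first exact: vertex_edge.
have [ij|/ltnW ji] := leqP i j; last by rewrite (eqP ji).
have iTi := invertibleM ig0 (Tm_invertible i).
have [M' [iM' yE [Z [Z' [E E']]]]] := hecke_walk_mx w erefl iTi.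
have [b Tj] := TmD i (j - i); rewrite subnKC// in Tj.
have iTj := invertibleM ig0 (Tm_invertible j).
have [e [Z0 [e0 uZ0 M'E]]] := cls_eqP iTj iM' (esym yE).
have uZV := lmapV uZ0; set T := mk2 _ b 0 1 in Tj.
have ZE : e *: lmap T = lmap (Z *m invmx Z0).
  apply: (can_inj (mulIK iTi)).
  rewrite KscaleAr -(mulmxA g0) -lmapM -Tj lmapM mulmxA -E M'E KscaleAl.
  by rewrite -(mulmxA _ (lmap Z0)) uZV mulmx1; reflexivity.
pose q := (Z *m invmx Z0) 1 1.
have eq : e = laurent_poly q.
  have <- : (e *: lmap T) 1 1 = e by rewrite mxE lmap_mk2 mk2E rmorph1 mulr1.
  by rewrite ZE mxE.
have ZE' : Z = q *: T *m Z0.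
  rewrite -[LHS](mulmxKV uZ0); congr (_ *m _); apply: lmap_inj; rewrite -ZE eq.
  by apply/matrixP => a a'; rewrite !mxE rmorphM.
have NE : (nu ^+ k)%:M = q *: T *m (Z0 *m Z').
  apply: lmap_inj; rewrite mulmxA -ZE' lmapM; apply: (can_inj (mulIK iTi)).
  rewrite mulmxA -E -E' lmap_scalar Kmul_mx_scalar rmorphXn; reflexivity.
have q0 : q != 0 by rewrite -lpoly_eq0 -eq.
move: (Z0 *m Z') NE => V; rewrite -scalemxAl /T (mk2_eta V) mk2M => NE.
have e10 := congr1 (fun A : 'M[{poly F}]_2 => A 1 0) NE.
have e00 := congr1 (fun A : 'M[{poly F}]_2 => A 0 0) NE.
rewrite /= mxE mulr0n mxE mk2E mul0r add0r mul1r in e10.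
rewrite /= mxE mulr1n mxE mk2E in e00.
have {}e10 : V 1 0 = 0.
  by apply/eqP; have /esym/eqP := e10; rewrite mulf_eq0 (negPf q0).
rewrite e10 mulr0 addr0 mulrCA in e00.
rewrite -(@dvdp_Pexp2l _ nu) ?e00 ?dvdp_mulIl//.
by case: nu_prime.
Qed.

End HeckeRay.

(** * Periods along a ray *)

Section VertexPeriods.
Variables (F : finFieldType) (nu : {poly F}).
Hypothesis nu_prime : irreducible_poly nu.
Local Notation K := (laurent F).
Implicit Types (Z V : 'M[{poly F}]_2).

(** Two powers of [Z] are congruent modulo [nu], since [F[Y]/nu] is finite. *)
Lemma power_congr1 Z : Z \in unitmx ->
  exists2 C, (0 < C)%N & exists V, Z ^+ C = 1 + nu *: V.
Proof.
move=> uZ; pose T := {ffun ('I_2 * 'I_2) * 'I_(size nu) -> F}.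
pose r (k : nat) : T :=
  [ffun q : ('I_2 * 'I_2) * 'I_(size nu) => ((Z ^+ k) q.1.1 q.1.2 %% nu)`_q.2].
have [i [j [ij rij]]] : exists i j, (i < j)%N /\ r i = r j.
  have /injectivePn[i [j ij rij]] : ~~ injectiveb (fun k : 'I_(#|T|.+1) => r k).
    apply/negP => /injectiveP /leq_card; by rewrite card_ord ltnn.
  move: ij; rewrite -(inj_eq val_inj) neq_ltn => /orP[ij|ji]; first by exists i, j.
  by exists j, i.
have mij a b : nu %| (Z ^+ j) a b - (Z ^+ i) a b.
  apply/modp_eq0P; rewrite modpD modpN; apply/eqP; rewrite subr_eq0; apply/eqP/polyP => k.
  have [knu|knu] := ltnP k (size nu); last first.
    have nu0 := nu_neq0 nu_prime.
    by rewrite !nth_default//; apply: leq_trans knu; apply: ltnW; rewrite ltn_modp.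
  have := congr1 (fun f : T => f ((a, b), Ordinal knu)) rij.
  by rewrite !ffunE /= => ->.
have [V VE] : exists V, Z ^+ j - Z ^+ i = nu *: V.
  exists (\matrix_(a, b) (((Z ^+ j) a b - (Z ^+ i) a b) %/ nu)).
  apply/matrixP => a b; rewrite !mxE mulrC divpK//; exact: mij.
exists (j - i)%N; first by rewrite subn_gt0.
have uZi : Z ^+ i \in unitmx by exact: unitrX.
exists (invmx (Z ^+ i) *m V).
apply: (can_inj (mulKmx uZi)).
rewrite -[1]/(1%:M) mulmxDr mulmx1 -scalemxAr mulKVmx// -VE.
rewrite -[_ *m _]/(_ * _) -exprD subnKC 1?ltnW//.
by rewrite addrC subrK.
Qed.

Variable p : nat.
Hypothesis pF : p \in [pchar F].

Lemma pchar_polymx : p \in [pchar 'M[{poly F}]_2].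
Proof.
have pP : p \in [pchar {poly F}] by exact: (rmorph_pchar (@polyC F)) pF.
exact: (rmorph_pchar (@scalar_mx {poly F} 2)) pP.
Qed.

Lemma frobenius_congr1 V e : (1 + nu *: V) ^+ (p ^ e) = 1 + nu ^+ (p ^ e) *: V ^+ (p ^ e).
Proof.
elim: e => [|e IH]; first by rewrite expn0 !expr1.
rewrite expnSr exprM IH -(pFrobenius_autE pchar_polymx) pFrobenius_autD_comm; last first.
  exact: commr_sym (commr1 _).
by rewrite !pFrobenius_autE expr1n exprZn -!exprM.
Qed.

(** The denominator [nu ^ n] of the inverse of [Tm n] is absorbed by [nu ^ q]. *)
Lemma Tm_conj n (c : nat -> {poly F}) Z V q : (n <= q)%N -> Z \in unitmx ->
  Z = 1 + nu ^+ q *: V ->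
  exists2 Z', Z' \in unitmx & Z *m Tm nu c n = Tm nu c n *m Z'.
Proof.
move=> nq uZ ZE; set T := Tm nu c n.
pose T' := mk2 1 (- digits nu c n) (- 0) (nu ^+ n).
have TT' : T *m T' = (nu ^+ n)%:M by rewrite /T /Tm mk2_adjM mulr1 mulr0 subr0.
pose Z' := 1%:M + nu ^+ (q - n) *: (T' *m V *m T).
have E : Z *m T = T *m Z'.
  rewrite ZE mulmxDl mul1mx mulmxDr mulmx1; congr (_ + _).
  rewrite -scalemxAl -scalemxAr !mulmxA TT' mul_scalar_mx -scalemxAl scalerA.
  by rewrite -exprD subnK.
exists Z' => //; have dT : \det T != 0.
  by rewrite mk2_det mulr1 mulr0 subr0; exact/expf_neq0/nu_neq0.
have /mulfI H := dT.
have := congr1 determinant E; rewrite !det_mulmx mulrC => /H dE.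
by rewrite unitmxE -dE -unitmxE.
Qed.

Lemma YmonX (P k : nat) : Ymon F P%:Z ^+ k = Ymon F (P * k)%N%:Z.
Proof.
elim: k => [|k IH]; first by rewrite muln0 expr0.
by rewrite exprS IH YmonM_nat mulnS.
Qed.

Lemma lunitX (u : K) k : lunit u -> lunit (u ^+ k).
Proof.
by move=> uu; elim: k => [|k IH]; [exact: lunit1|rewrite exprS; exact: lunitM].
Qed.

Lemma period_matrix P (g : 'M[K]_2) : invertible g -> period P (cls g) ->
  exists u s Z, [/\ lunit u, s != 0, Z \in unitmx &
    dg (Ymon F P%:Z * u) *m g = s *: (g *m lmap Z)].
Proof.
move=> ig [u uu]; have a0 := Ymon_unit_neq0 P%:Z uu.
rewrite /tor (mact_cls (dg_invertible a0) ig) => E.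
have [s [Z [s0 uZ ZE]]] := cls_eqP ig (invertibleM (dg_invertible a0) ig) E.
by exists u, s, Z; split.
Qed.

Lemma dg_pow (a s : K) (g : 'M[K]_2) Z k : dg a *m g = s *: (g *m lmap Z) ->
  dg (a ^+ k) *m g = s ^+ k *: (g *m lmap (Z ^+ k)).
Proof.
move=> E; elim: k => [|k IH].
  by rewrite !expr0 Kscale1 lmap1 mulmx1 dg1 mul1mx; reflexivity.
rewrite exprS -dgM -mulmxA IH KscaleAr mulmxA E KscaleAl KscaleA.
rewrite (exprS Z) -[Z * _]/(Z *m _) lmapM mulmxA exprSr; reflexivity.
Qed.

(** In the basis [g], the period is an integral matrix, with a power [1 + nu V]. In
    characteristic [p], [(1 + nu V)^(p^e) = 1 + nu^(p^e) V^(p^e)], which preserves the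
    lattices at distance at most [p^e] along the ray. So the period of these vertices is
    at most proportional to the distance, although the number of vertices at this
    distance is exponential: this is what lets a fixed orbit keep a definite proportion of
    the mass. *)
Lemma vertex_period P (g : 'M[K]_2) : invertible g -> period P (cls g) ->
  exists2 C, (0 < C)%N & forall (c : nat -> {poly F}) n e, (n <= p ^ e)%N ->
    period (P * (C * p ^ e)) (vertex nu g c n).
Proof.
move=> ig pg; have [u [s [Z [uu s0 uZ E]]]] := period_matrix ig pg.
have [C C0 [V ZC]] := power_congr1 uZ; exists C => // c n e ne.
set k := (C * p ^ e)%N.
have ZkE : Z ^+ k = 1 + nu ^+ (p ^ e) *: V ^+ (p ^ e).
  by rewrite /k exprM ZC frobenius_congr1.
have [Z' uZ' TE] := Tm_conj c ne (unitrX k uZ : Z ^+ k \in unitmx) ZkE.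
have iT := Tm_invertible nu_prime c n; have igT := invertibleM ig iT.
exists (u ^+ k); first exact: lunitX.
have aE : Ymon F (P * k)%N%:Z * u ^+ k = (Ymon F P%:Z * u) ^+ k by rewrite exprMn YmonX.
have a0 : Ymon F (P * k)%N%:Z * u ^+ k != 0 by apply: Ymon_unit_neq0; exact: lunitX.
rewrite /vertex /tor (mact_cls (dg_invertible a0) igT) aE.
rewrite mulmxA (dg_pow k E) KscaleAl -mulmxA -lmapM TE lmapM mulmxA.
rewrite (cls_scale (invertibleM igT (lmap_unitmx uZ')) (expf_neq0 k s0)).
exact: cls_mulr.
Qed.

End VertexPeriods.

(** * Limits of measures on compact open sets *)

(** A copy of the space of lattices that carries the ring of its compact open sets
    instead of its Borel sets. *)
Definition lattice_ring (F : finFieldType) : Type := hspace F.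

Section CompactOpenRing.
Variable F : finFieldType.
Implicit Types (W : set (hspace F)) (s : nat).

Definition compact_open W := compact W /\ exists s, invariant s W.

Lemma compact_open0 : compact_open set0.
Proof. by split; [exact: compact0|exists 0%N => A y]. Qed.

Lemma compact_openU : setU_closed compact_open.
Proof.
move=> W W' [cW [s Wi]] [cW' [s' Wi']]; split; first exact: compactU.
exists (maxn s s'); apply: invariantU; first exact: invariantW (leq_maxl _ _) Wi.
exact: invariantW (leq_maxr _ _) Wi'.
Qed.

Lemma compact_openD : setD_closed compact_open.
Proof.
move=> W W' [cW [s Wi]] [cW' [s' Wi']].
have Wi2 : invariant (maxn s s') (W `\` W').
  rewrite setDE; apply: invariantI; first exact: invariantW (leq_maxl _ _) Wi.
  exact: invariantC (invariantW (leq_maxr _ _) Wi').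
split; last by exists (maxn s s').
apply: subclosed_compact cW _; first exact: invariant_closed Wi2.
exact: subDsetl.
Qed.

Definition compact_open_display : measure_display. Proof. exact. Qed.

HB.instance Definition _ := Pointed.copy (lattice_ring F) (hspace F).
HB.instance Definition _ := @isRingOfSets.Build compact_open_display
  (lattice_ring F) compact_open compact_open0 compact_openU compact_openD.

Lemma compact_open_nhd s (y : hspace F) : compact_open (nhd s y).
Proof. by split; [exact: nhd_compact|exists s; exact: nhd_invariant]. Qed.

Lemma compact_open_open W : compact_open W -> open W.
Proof. by move=> [_ [s Wi]]; exact: invariant_open Wi. Qed.

Lemma compact_open_borel W : compact_open W -> measurable (W : set (borel F)).
Proof. by move=> /compact_open_open; exact: open_measurable_borel. Qed.

(** By second countability the compact open sets generate the Borel sets. *)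
Lemma borel_generated : @measurable _ (borel F) `<=`
  @measurable _ (g_sigma_algebraType (@measurable _ (lattice_ring F))).
Proof.
apply: smallest_sub; first exact: sigma_algebra_measurable.
move=> U oU.
have [y_ yP] := choice (@countable_orbits F).
have -> : U = \bigcup_s \bigcup_(n in [set n | nhd s (y_ s n) `<=` U]) nhd s (y_ s n).
  apply/seteqP; split=> [z Uz|z [s _ [n /= nU]]]; last exact: nU.
  have /hspace_openP/(_ z Uz)[s sU] := oU.
  have [n nz] := yP s z; exists s => //; exists n => //=.
  by move=> w nw; have [A As <-] := nhd_trans (nhd_sym nz) nw; exact: sU.
apply: bigcupT_measurable => s; apply: bigcup_measurable => n _.
by apply: sub_sigma_algebra; exact: compact_open_nhd.
Qed.

End CompactOpenRing.

Section UltraLimit.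
Variables (R : realType) (G : set_system nat).
Hypothesis UG : UltraFilter G.

Lemma ultra_limit (u : nat -> R) : (forall n, 0 <= u n <= 1) ->
  exists l : R, u @ G --> l.
Proof.
move=> u01; have PG : ProperFilter G by exact: ultra_proper.
have [l [_ cl]] : `[0, 1]%classic `&` cluster (u @ G) !=set0.
  apply: (@segment_compact R 0 1).
  by apply: (@filterS _ G _ setT); [move=> n _; rewrite /= in_itv; exact: u01|exact: filterT].
exists l; apply/cvgrPdist_lt => e e0.
have [//|nG] := in_ultra_setVsetC [set n | `|l - u n| < e] UG.
have [r [[n nGn <-]]] := cl (u @` (~` [set n | `|l - u n| < e])) (ball l e)
  (filterS (fun n (H : (~` [set n | `|l - u n| < e]) n) => ex_intro2 _ _ n H erefl) nG)
  (nbhsx_ballx l _ e0).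
by [].
Qed.

End UltraLimit.

Section WeakLimit.
Variables (F : finFieldType) (R : realType).
Variables (m : nat -> probability (borel F) R) (G : set_system nat).
Hypothesis UG : UltraFilter G.
Implicit Types (W : set (hspace F)).

Let PG : ProperFilter G. Proof. exact: ultra_proper. Qed.

(** Truncated at [1] in order to be bounded on all sets. *)
Definition mass W n : R := Num.min 1 (fine (m n (W : set (borel F)))).

Lemma massE W n : measurable (W : set (borel F)) -> m n W = (mass W n)%:E.
Proof.
move=> mW; have W1 := probability_le1 (m n) mW.
have fW : m n W \is a fin_num by exact: fin_num_measure.
by rewrite /mass min_r ?fineK// -lee_fin fineK.
Qed.

Lemma mass01 W n : 0 <= mass W n <= 1.
Proof. by rewrite le_min ler01 ge_min lexx /= andbT fine_ge0. Qed.

Definition limit_mass W : R := projT1 (cid (ultra_limit UG (mass01 W))).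

Lemma limit_massP W : mass W @ G --> limit_mass W.
Proof. by rewrite /limit_mass; case: cid. Qed.

Lemma limit_massE W (l : R) : mass W @ G --> l -> limit_mass W = l.
Proof.
move=> Wl; rewrite -(cvg_lim (@Rhausdorff R) Wl); apply/esym.
by apply: (cvg_lim (@Rhausdorff R)); exact: limit_massP.
Qed.

Lemma limit_mass_ge0 W : 0 <= limit_mass W.
Proof.
apply: (cvgr_to_ge (limit_massP (W := W))); apply: nearW => n.
by have /andP[] := mass01 W n.
Qed.

Lemma limit_mass_le1 W : limit_mass W <= 1.
Proof.
apply: (cvgr_to_le (limit_massP (W := W))); apply: nearW => n.
by have /andP[] := mass01 W n.
Qed.

Definition limit_content (W : set (lattice_ring F)) : \bar R := (limit_mass W)%:E.

Lemma limit_content0 : limit_content set0 = 0%E.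
Proof.
congr EFin; apply: limit_massE.
rewrite (_ : mass set0 = cst 0); first exact: cvg_cst.
by apply/funext => n; apply/EFin_inj; rewrite -massE// measure0.
Qed.

Lemma limit_content_ge0 W : (0 <= limit_content W)%E.
Proof. by rewrite lee_fin limit_mass_ge0. Qed.

Lemma limit_content_semi_additive : measure_function.semi_additive limit_content.
Proof.
apply/(additive2P limit_content0) => W W' cW cW' WW'.
have mW := compact_open_borel cW; have mW' := compact_open_borel cW'.
rewrite /limit_content -EFinD; congr EFin.
apply: limit_massE.
rewrite (_ : mass (W `|` W') = mass W + mass W'); last first.
  apply/funext => n; apply/EFin_inj; rewrite EFinD -!massE//; last exact: measurableU.
  by rewrite measureU.
by apply: cvgD; exact: limit_massP.
Qed.

HB.instance Definition _ := isContent.Build _ _ R limit_content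
  limit_content_ge0 limit_content_semi_additive.

(** A countable cover of a compact set by open sets has a finite subcover. *)
Lemma limit_content_sigma_subadditive :
  measurable_subset_sigma_subadditive limit_content.
Proof.
move=> A W cW [cA [s Ai]] AW.
have cA' : cover_compact (A : set (hspace F)) by rewrite -compact_cover.
have [//|D _ AD] := cA' nat setT W (fun i _ => compact_open_open (cW i)).
pose n := (\max_(i <- finmap.enum_fset D) i).+1.
have An : A `<=` \big[setU/set0]_(k < n) W k.
  move=> z /AD[i /= iD Wz]; rewrite -bigcup_mkord; exists i => //=.
  by rewrite /n ltnS; apply: leq_bigmax_seq.
have cA2 : compact_open A by split; [exact: cA|exists s].
apply: (le_trans (content_subadditive limit_content (fun i _ => cW i) cA2 An)).
rewrite -(big_mkord xpredT (fun k => limit_content (W k))).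
by apply: nneseries_lim_ge => k _ _; exact: limit_content_ge0.
Qed.

HB.instance Definition _ := Content_SigmaSubAdditive_isMeasure.Build _ _ _
  limit_content limit_content_sigma_subadditive.

Definition limit_measure (E : set (borel F)) : \bar R := measure_extension limit_content E.

Lemma limit_measure0 : limit_measure set0 = 0%E.
Proof. exact: (measure0 (measure_extension limit_content)). Qed.

Lemma limit_measure_ge0 E : (0 <= limit_measure E)%E.
Proof. exact: (measure_ge0 (measure_extension limit_content)). Qed.

Lemma limit_measure_sigma_additive : semi_sigma_additive limit_measure.
Proof.
move=> E mE tE mUE.
apply: (@measure_semi_sigma_additive _ _ _ (measure_extension limit_content) E) => //.
- by move=> i; exact: borel_generated.
- exact: borel_generated.
Qed.

HB.instance Definition _ := isMeasure.Build _ _ R limit_measure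
  limit_measure0 limit_measure_ge0 limit_measure_sigma_additive.

Lemma limit_measureE W : compact_open W -> limit_measure W = (limit_mass W)%:E.
Proof.
move=> cW; exact: (measurable_mu_extE limit_content cW).
Qed.

Lemma le_limit_measure (E : set (borel F)) (b : \bar R) :
  (forall W : nat -> set (hspace F), (forall i, compact_open (W i)) ->
    E `<=` \bigcup_i W i -> (b <= \sum_(i <oo) (limit_mass (W i))%:E)%E) ->
  (b <= limit_measure E)%E.
Proof.
by move=> bP; apply/le_ereal_inf_tmp => _ [W [mW EW] <-]; exact: bP.
Qed.

End WeakLimit.

(** * Weak-star accumulation points *)

Section StepFunctions.
Variables (F : finFieldType) (R : realType).
Implicit Types (f : hspace F -> R) (W : nat -> set (borel F)).

Lemma continuous_borel f : continuous f -> measurable_fun setT (f : borel F -> R).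
Proof.
move=> /continuousP cf; apply: (measurability _ (RGenOpens.measurableE R)).
move=> _ [_ [a [b ->] <-]]; rewrite setTI; apply: open_measurable_borel.
by apply: cf; exact: interval_open.
Qed.

Lemma step_integral (m : {measure set (borel F) -> \bar R}) W f (v : nat -> R) n (e : R) :
  (forall i, measurable (W i)) -> trivIset setT W -> (forall i, (m (W i) < +oo)%E) ->
  continuous f -> (exists B : R, forall z, `|f z| <= B) ->
  (forall i z, (i < n)%N -> W i z -> `|f z - v i| <= e) ->
  `| \int[m]_(z in \big[setU/set0]_(i < n) W i) f z - \sum_(i < n) v i * fine (m (W i)) |
    <= e * fine (m (\big[setU/set0]_(i < n) W i)).
Proof.
move=> mW tW fW cf [B fB]; have mf := continuous_borel cf.
have mU k : measurable (\big[setU/set0]_(i < k) W i) by exact: bigsetU_measurable.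
have fU k : (m (\big[setU/set0]_(i < k) W i) < +oo)%E.
  by rewrite (measure_bigsetU m mW tW); apply: lte_sum_pinfty => i _; exact: fW.
have intf (A : set (borel F)) : measurable A -> (m A < +oo)%E -> m.-integrable A (EFin \o f).
  move=> mA fA; apply: measurable_bounded_integrable => //.
    exact: measurable_funS mf.
  by exists B; split; [exact: num_real|move=> x Bx z _; exact: le_trans (fB z) (ltW Bx)].
have intc (A : set (borel F)) (c : R) : measurable A -> (m A < +oo)%E ->
    m.-integrable A (EFin \o cst c).
  move=> mA fA; apply: measurable_bounded_integrable => //.
  exact: bounded_cst.
elim: n => [|n IH] fv.
  by rewrite !big_ord0 Rintegral_set0 subr0 normr0 measure0 mulr0.
have dW : [disjoint \big[setU/set0]_(i < n) W i & W n].
  rewrite disj_set2E; apply/eqP; rewrite -bigcup_mkord setI_bigcupl.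
  apply/seteqP; split=> // z [i /= iN [Wi Wn]].
  by move: iN; rewrite (tW i n I I _) ?ltnn//; exists z.
rewrite !big_ord_recr /=.
have intU : m.-integrable (\big[setU/set0]_(i < n) W i `|` W n) (EFin \o f).
  by have := intf _ (mU n.+1) (fU n.+1); rewrite big_ord_recr.
rewrite (Rintegral_setU (mU n) (mW n) intU dW).
have UW : (m (\big[setU/set0]_(i < n) W i `|` W n) =
    m (\big[setU/set0]_(i < n) W i) + m (W n))%E.
  by rewrite measureU//; apply/eqP; rewrite -disj_set2E.
rewrite UW fineD ?ge0_fin_numE// mulrDr opprD addrACA (le_trans (ler_normD _ _))//.
apply: lerD; first by apply: IH => i z iN; apply: fv; exact: ltnW.
rewrite -(Rintegral_cst m (mW n) (v n)) -RintegralB//; [|exact: intf|exact: intc].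
rewrite -(Rintegral_cst m (mW n) e).
have intB : m.-integrable (W n) (EFin \o (fun z => f z - v n)).
  by have := integrableB (mW n) (intf _ (mW n) (fW n)) (intc _ (v n) (mW n) (fW n)).
apply: (le_trans (le_normr_Rintegral (mW n) intB)).
apply: le_Rintegral => //.
- by have := integrable_norm intB.
- exact: intc.
- by move=> z Wz; apply: fv.
Qed.

Lemma compactly_supported_bounded f : compactly_supported f ->
  exists B : R, forall z, `|f z| <= B.
Proof.
move=> [cf kf].
have /compact_bounded[M [_ MP]] :=
  continuous_compact (continuous_subspaceT cf) kf.
exists (`|M| + 1) => z; have [->|f0] := eqVneq (f z) 0.
  by rewrite normr0 addr_ge0.
apply: MP; first by rewrite (le_lt_trans (ler_norm M))// ltrDl.
by exists z => //; exact: subset_closure.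
Qed.

(** Integrals of a test function reduce, up to [e], to the masses of finitely many
    compact open sets. *)
Lemma step_approximation f (e : R) : compactly_supported f -> 0 < e ->
  exists n (W : nat -> set (hspace F)) (v : nat -> R),
    (forall i, compact_open (W i)) /\
    forall m : {measure set (borel F) -> \bar R},
      (forall V, compact_open V -> (m V <= 1)%E) ->
      `| \int[m]_z f z - \sum_(i < n) v i * fine (m (W i)) | <= e.
Proof.
move=> fK e0; have fB := compactly_supported_bounded fK; have [cf kf] := fK.
have /choice[s sP] : forall y, exists s, forall z, nhd s y z -> `|f z - f y| <= e.
  move=> y; have /cvgrPdist_le/(_ _ e0)/nbhs_hspaceP[s sf] := cf y.
  by exists s => z /sf; rewrite distrC.
have kf' : cover_compact (closure [set z | f z != 0]) by rewrite -compact_cover.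
have [||D _ DP] := kf' (hspace F) setT (fun y => nhd (s y) y).
- by move=> y _; apply: invariant_open; exact: nhd_invariant.
- by move=> z _; exists z => //; exact: nhd_refl.
pose t := finmap.enum_fset D.
pose U i := if (i < size t)%N then nhd (s (nth point t i)) (nth point t i) else set0.
have cU i : compact_open (U i).
  by rewrite /U; case: ifP => _; [exact: compact_open_nhd|exact: compact_open0].
have cW i : compact_open (seqDU U i).
  by apply: compact_openD => //; elim/big_ind : _ => // ; [exact: compact_open0|exact: compact_openU].
exists (size t), (seqDU U), (fun i => f (nth point t i)); split=> // m m1.
have mfin V : compact_open V -> (m V < +oo)%E.
  by move=> /m1 /le_lt_trans; apply; rewrite ltry.
have cUn n : compact_open (\big[setU/set0]_(i < n) seqDU U i).
  by elim/big_ind : _ => // ; [exact: compact_open0|exact: compact_openU].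
rewrite (_ : \int[m]_z f z = \int[m]_(z in \big[setU/set0]_(i < size t) seqDU U i) f z).
  have fW i z : (i < size t)%N -> seqDU U i z -> `|f z - f (nth point t i)| <= e.
    by move=> it [+ _]; rewrite /U it; exact: sP.
  have mW i : measurable (seqDU U i : set (borel F)) by exact: compact_open_borel.
  apply: (le_trans (step_integral mW (trivIset_seqDU U) (fun i => mfin _ (cW i)) cf fB fW)).
  rewrite ger_pMr// -lee_fin fineK; first exact: m1.
  by rewrite ge0_fin_numE//; exact: mfin.
rewrite [RHS]Rintegral_mkcond; congr (Rintegral _ _ _); apply/funext => z.
rewrite patchE; case: ifPn => // /negP zU; apply: contrapT => /eqP fz; apply: zU.
rewrite inE -bigsetU_seqDU -bigcup_mkord.
have [y yD yz] := DP z (@subset_closure _ [set z | f z != 0] z fz).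
have yt : y \in t by [].
exists (index y t); rewrite /= ?index_mem// /U index_mem yt nth_index//.
Qed.

End StepFunctions.
Section WeakLimitExists.
Variables (F : finFieldType) (R : realType).

(** The limit of the masses of the compact open sets along a nonprincipal ultrafilter
    is a content, and extends to a measure by Caratheodory's theorem. A domination of
    measures passes to the limit on compact open sets, hence to the outer measures. *)
Theorem weak_limit (m : nat -> probability (borel F) R) :
  exists theta : {measure set (borel F) -> \bar R},
    weak_star_accumulation m theta /\
    forall (c : R) (m' : probability (borel F) R), 0 <= c ->
      (forall W, compact_open W -> exists N, forall n, (N <= n)%N ->
        (c%:E * m' W <= m n W)%E) ->
      forall E : set (borel F), measurable E -> (c%:E * m' E <= theta E)%E.
Proof.
have [G [UG GN]] := ultraFilterLemma (eventually_filter).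
have PG : ProperFilter G by exact: ultra_proper.
pose theta : {measure set (borel F) -> \bar R} := limit_measure m UG.
have thE W : compact_open W -> theta W = (limit_mass m UG W)%:E by exact: limit_measureE.
have th1 W : compact_open W -> (theta W <= 1)%E.
  by move=> cW; rewrite (thE _ cW) lee_fin limit_mass_le1.
exists theta; split; first split.
- move=> C kC.
  have kC' : cover_compact C by rewrite -compact_cover.
  have [||D _ DP] := kC' (hspace F) setT (fun y => nhd 0 y).
  + by move=> y _; apply: invariant_open; exact: nhd_invariant.
  + by move=> z _; exists z => //; exact: nhd_refl.
  have cU : compact_open (\big[setU/set0]_(y <- finmap.enum_fset D) nhd 0 y).
    elim/big_ind : _ => // [||y _]; [exact: compact_open0|exact: compact_openU|].
    exact: compact_open_nhd.
  apply: (@le_lt_trans _ _ (theta (\big[setU/set0]_(y <- finmap.enum_fset D) nhd 0 y))).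
    apply: le_measure; rewrite ?inE.
    + exact: compact_measurable_borel.
    + exact: compact_open_borel.
    + by move=> z /DP[y yD yz]; rewrite -bigcup_seq; exists y.
  by apply: le_lt_trans (th1 _ cU) _; rewrite ltry.
- move=> k f fK e N e0.
  have e3 : 0 < e / 3 by rewrite divr_gt0.
  have near_i i : G [set n | `|\int[m n]_x f i x - \int[theta]_x f i x| < e].
    have [l [W [v [cW WP]]]] := step_approximation (fK i) e3.
    have fineE V (n : nat) : compact_open V -> fine (m n V) = mass m V n.
      by move=> cV; rewrite massE//; exact: compact_open_borel.
    have lim : (fun n => \sum_(i < l) v i * mass m (W i) n) @ G -->
        \sum_(i < l) v i * limit_mass m UG (W i).
      elim: l {WP} => [|l IH].
        under eq_fun do rewrite big_ord0.
        by rewrite big_ord0; exact: cvg_cst.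
      under eq_fun do rewrite big_ord_recr.
      rewrite big_ord_recr; apply: cvgD; first exact: IH.
      by apply: cvgMr; exact: limit_massP.
    have /cvgrPdist_lt/(_ _ e3) := lim.
    apply: filterS => n /= ne.
    have := WP theta th1; have := WP (m n) (fun V cV => probability_le1 _ (compact_open_borel cV)).
    under eq_bigr do rewrite fineE//.
    under [X in _ -> `|_ - X| <= _ -> _]eq_bigr do rewrite thE//=.
    move: ne; set a := \sum_(i < l) _; set b := \sum_(i < l) _.
    rewrite !(ltr_distl, ler_distl) => /andP[? ?] /andP[? ?] /andP[? ?].
    apply/andP; split; lra.
  have GN' : G [set n | (N <= n)%N] by apply: GN; exists N.
  have [n [nN nf]] := filter_ex (filterI GN' (filter_forall _ near_i)).
  by exists n.
- move=> c m' c0 H E mE; apply: le_limit_measure => W cW EW.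
  have mW i := compact_open_borel (cW i).
  apply: (@le_trans _ _ (c%:E * \sum_(i <oo) m' (W i))%E).
    rewrite lee_wpmul2l ?lee_fin//; apply: measure_sigma_subadditive => //.
  rewrite -nneseriesZl//; apply: lee_nneseries => i _.
    by rewrite mule_ge0.
  have fW : m' (W i) \is a fin_num by exact: fin_num_measure.
  rewrite -(fineK fW) -EFinM lee_fin.
  apply: (cvgr_to_ge (limit_massP (UG := UG) (W := W i))).
  have [N HN] := H _ (cW i).
  apply: filterS (GN [set n | (N <= n)%N] _); last by exists N.
  by move=> n /= /HN; rewrite massE// -(fineK fW) -EFinM lee_fin.
Qed.

End WeakLimitExists.

(** * Singularity of periodic orbits *)

Section Singularity.
Variable F : finFieldType.
Local Notation K := (laurent F).
Implicit Types (z : hspace F) (s b : K).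

Lemma upu_invertible s : invertible (upu s).
Proof. by apply/invertible_mk2; rewrite mulr1 mulr0 subr0; exact: oner_neq0. Qed.

Lemma upuD s s' : upu s *m upu s' = upu (s + s').
Proof. by rewrite /upu mk2M !(mulr0, mul0r, mulr1, mul1r, addr0, add0r) addrC. Qed.

Lemma mact_upuB s s' z : mact (upu (s' - s)) (mact (upu s) z) = mact (upu s') z.
Proof.
by rewrite (mactM _ (upu_invertible _) (upu_invertible _)) upuD subrK.
Qed.

Lemma dg_upu b s : dg b *m upu s = upu (b * s) *m dg b.
Proof. by rewrite /upu /dg !mk2M !(mulr0, mul0r, mulr1, mul1r, addr0, add0r). Qed.

Lemma near1_upu t s : bnd (- t.+1%:Z) s -> near1 t (upu s).
Proof.
move=> st; rewrite /near1 -mk2_1; apply: ord2P; apply: ord2P; rewrite mxE [X in _ + X]mxE !mk2E.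
- by rewrite subrr; exact: bnd0.
- by rewrite subr0.
- by rewrite subrr; exact: bnd0.
- by rewrite subrr; exact: bnd0.
Qed.

(** Let [a = Y^(- P) / u], which contracts the unipotent subgroup. If [a] fixes
    [z] and [u_s z], then [u_s z = a^n u_s z = u_(a^n s) z] tends to [z], so that
    [u_s] fixes [z], as well as the [u_(a^n s)], which tend to the identity; but
    stabilizers are discrete. *)
Lemma unipotent_transverse (P : nat) (u : K) z s : (0 < P)%N -> lunit u ->
  tor (Ymon F P%:Z * u) z = z ->
  tor (Ymon F P%:Z * u) (mact (upu s) z) = mact (upu s) z -> s = 0.
Proof.
move=> P0 uu; set b := Ymon F P%:Z * u => bz bz'.
have b0 : b != 0 by exact: Ymon_unit_neq0.
have ib := dg_invertible (invr_neq0 b0).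
have az w : tor b w = w -> tor b^-1 w = w by move=> {1}<-; exact: torK.
have E n : mact (upu s) z = mact (upu (b^-1 ^+ n * s)) z.
  elim: n => [|n IH]; first by rewrite expr0 mul1r.
  rewrite -[LHS](az _ bz') IH /tor (mactM _ ib (upu_invertible _)) dg_upu mulrA -exprS.
  by rewrite -(mactM _ (upu_invertible _) ib) -/(tor _ _) (az _ bz).
have [d sd] := bnd_ex s.
have bn n : bnd (d - n%:Z) (b^-1 ^+ n * s).
  elim: n => [|n IH]; first by rewrite expr0 mul1r subr0.
  rewrite exprS -mulrA; set w := _ * s in IH *; rewrite /b invfM YmonV -mulrA.
  have uw := bndM (lunitV uu).1 IH.
  by apply: (bndMW _ (@Ymon_bnd F (- P%:Z)) uw); lia.
have small t : exists2 n, near1 t (upu (b^-1 ^+ n * s)) & mact (upu (b^-1 ^+ n * s)) z = mact (upu s) z.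
  by exists (`|d| + t.+1)%N => //; apply: near1_upu; apply: bndW (bn _); lia.
have zz : mact (upu s) z = z.
  by apply: nhd_separated => t; have [n nt <-] := small t; exists (upu (b^-1 ^+ n * s)).
have [A iA zA] := cls_ex z.
have [t tP] := stab_discrete iA; have [n nt nz] := small t.
have [|c c0 /(congr1 (fun M : 'M[K]_2 => M 0 1))] := tP _ nt.
  by rewrite -zA nz.
rewrite mk2E mxE mulr0n => /eqP; rewrite mulf_eq0 expf_eq0 invr_eq0 (negPf b0) andbF /=.
by move/eqP.
Qed.

Lemma act_measurable (g : @GL2 F) (C : set (hspace F)) : compact C ->
  measurable (act g @^-1` C : set (borel F)).
Proof.
move=> cC; apply: closed_measurable_borel.
have -> : act g = mact (\val g) by apply/funext => z; rewrite act_mact.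
apply: closed_comp => [z _|]; first exact/mact_continuous/val_unit.
exact: compact_closed (@hspace_hausdorff F) cC.
Qed.

(** The translates of the orbit by the unipotent subgroup are pairwise disjoint
    and have the same measure. *)
Lemma homogeneous_diag_orbit (R : realType) (m : probability (borel F) R) x P :
  homogeneous_measure m -> (0 < P)%N -> period P x -> m (diag_orbit x) = 0%E.
Proof.
move=> hm P0 px; have cx := period_compact P0 px.
pose g (i : nat) : @GL2 F := GLof (upu (Ymon F i%:Z)).
have gE i w : act (g i) w = mact (upu (Ymon F i%:Z)) w by rewrite mactE.
have mx : measurable (diag_orbit x : set (borel F)) by exact: compact_measurable_borel.
rewrite -(hm (g 0%N) _ mx).
apply: (@equal_disjoint_null _ _ _ m (fun i => act (g i) @^-1` diag_orbit x)).
- by move=> i; exact: act_measurable.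
- apply/trivIsetP => i j _ _ ij; apply/seteqP; split=> // w [].
  rewrite diag_orbitE /= => -[a a0 az] [a' a0' az'].
  have [u uu ux] := px; have b0 := Ymon_unit_neq0 P%:Z uu.
  have fixed c : c != 0 -> tor (Ymon F P%:Z * u) (tor c x) = tor c x.
    by move=> c0; rewrite torM// mulrC -torM// ux.
  have E : mact (upu (Ymon F j%:Z - Ymon F i%:Z)) (tor a x) = tor a' x.
    exact: etrans (congr1 (mact _) (etrans az (gE i w)))
      (etrans (mact_upuB _ _ _) (esym (etrans az' (gE j w)))).
  have := @unipotent_transverse P u (tor a x) (Ymon F j%:Z - Ymon F i%:Z) P0 uu (fixed _ a0).
  rewrite E => /(_ (fixed _ a0')) /eqP; rewrite subr_eq0 => /eqP Yij.
  have := congr1 (fun y : K => y j%:Z) Yij; rewrite /= eqxx.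
  case: eqP => [[ji]|_ /eqP]; last by rewrite oner_eq0.
  by rewrite ji eqxx in ij.
- by move=> i; exact: etrans (hm (g i) _ mx) (esym (hm (g 0%N) _ mx)).
Qed.

End Singularity.

(** * The ray and its limit measure *)

(** The property [good k c n] concerns the first [n] terms of [c]: each stage prolongs the
    prefix chosen at the previous one, and the prefixes converge. *)
Lemma prolongation (T : Type) (good : nat -> (nat -> T) -> nat -> Prop) (c0 : nat -> T) :
  (forall k c c' n, (forall i, (i < n)%N -> c i = c' i) -> good k c n -> good k c' n) ->
  (forall k c m, exists c' n,
    [/\ (m < n)%N, forall i, (i < m)%N -> c' i = c i & good k c' n]) ->
  exists c n_, forall k, (k <= n_ k)%N /\ good k c (n_ k).
Proof.
move=> gext gstep.
have /choice[f fP] : forall a : nat * (nat -> T) * nat, exists b : (nat -> T) * nat,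
    [/\ (a.2 < b.2)%N, forall i, (i < a.2)%N -> b.1 i = a.1.2 i & good a.1.1 b.1 b.2].
  by move=> [[k c] m]; have [c' [n H]] := gstep k c m; exists (c', n).
pose st := fix st k := if k is k'.+1 then f (k', (st k').1, (st k').2) else (c0, 0%N).
have stS k : [/\ ((st k).2 < (st k.+1).2)%N,
    forall i, (i < (st k).2)%N -> (st k.+1).1 i = (st k).1 i & good k (st k.+1).1 (st k.+1).2].
  exact: (fP (k, (st k).1, (st k).2)).
have st_ge k : (k <= (st k).2)%N.
  by elim: k => // k IH; have [H _ _] := stS k; exact: leq_ltn_trans IH H.
have st_mono (k l : nat) : ((st k).2 <= (st (k + l)).2)%N.
  elim: l => [|l IH]; first by rewrite addn0.
  by rewrite addnS; have [/ltnW H _ _] := stS (k + l)%N; exact: leq_trans IH H.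
have st_stable (k l i : nat) : (i < (st k).2)%N -> (st (k + l)%N).1 i = (st k).1 i.
  move=> ik; elim: l => [|l IH]; first by rewrite addn0.
  by rewrite addnS; have [_ H _] := stS (k + l)%N; rewrite H ?IH//; exact: leq_trans ik (st_mono _ _).
exists (fun i => (st i.+1).1 i), (fun k => (st k.+1).2) => k; split.
  exact: leq_trans (leqnSn k) (st_ge _).
have [_ _] := stS k; apply: gext => i ik.
have [ki|ik'] := leqP k.+1 i.+1.
  by rewrite -(subnKC ki) st_stable.
by rewrite -(subnKC (ltnW ik')) st_stable.
Qed.

Section Approximation.
Variables (F : finFieldType) (R : realType) (nu : {poly F}).
Hypothesis nu_prime : irreducible_poly nu.
Variable p : nat.
Hypothesis pF : p \in [pchar F].
Local Notation K := (laurent F).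

Lemma vertex_ext (g0 : 'M[K]_2) (c c' : nat -> {poly F}) n :
  (forall i, (i < n)%N -> c i = c' i) -> vertex nu g0 c n = vertex nu g0 c' n.
Proof.
move=> cc'; have E : digits nu c n = digits nu c' n by apply: eq_bigr => i _; rewrite cc'.
by rewrite /vertex /Tm E.
Qed.

(** Put [b] at position [m], followed by zeros. *)
Lemma Tm_jump (c : nat -> {poly F}) m j b : (0 < j)%N -> exists2 c',
  (forall i, (i < m)%N -> c' i = c i) & Tm nu c' (m + j) = Tm nu c m *m mk2 (nu ^+ j) b 0 1.
Proof.
move=> j0; exists (fun i => if (i < m)%N then c i else if i == m then b else 0) => [i ->//|].
rewrite /Tm mk2M !(mulr0, mul0r, mulr1, addr0, mul1r, add0r) exprD; congr mk2.
rewrite /digits big_split_ord /= addrC; congr (_ + _).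
  case: j j0 => // j _; rewrite big_ord_recl /= addn0 ltnn eqxx big1 ?addr0// => i _.
  by rewrite ltnNge leq_addr /= gtn_eqF ?mulr0// -[X in (X < _)%N]addn0 ltn_add2l.
by apply: eq_bigr => i _; rewrite ltn_ord.
Qed.

Variables (g0 h : 'M[K]_2) (mu : hspace F -> probability (borel F) R).
Hypothesis ig0 : invertible g0.
Hypothesis ih : invertible h.
Hypothesis mu_orbit : forall x, diag_periodic x -> orbit_measure x (mu x).

(** Choose a power [q] of [p] that is large compared with [m] and with the constants of the
    approximation. From the vertex [m], reach a point that agrees with the orbit of
    [cls h] to precision about [q / 6], at a distance at most [q]: its period is at most
    [P0 * C * q], and it follows the orbit of [cls h] during a time at least [q / 12]. *)
Lemma vertex_shadow (P0 C Px : nat) : (0 < P0)%N -> (0 < C)%N -> (0 < Px)%N ->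
  (forall (c : nat -> {poly F}) n e, (n <= p ^ e)%N ->
    period (P0 * (C * p ^ e)) (vertex nu g0 c n)) ->
  period Px (cls h) ->
  forall k (c : nat -> {poly F}) m, exists c' n,
  [/\ (m < n)%N, forall i, (i < m)%N -> c' i = c i
    & forall W, invariant k W ->
      (((12 * (P0 * C))%:R^-1 : R)%:E * mu (cls h) W <= mu (vertex nu g0 c' n) W)%E].
Proof.
move=> P00 C0 Px0 vper px k c m.
have ig := invertibleM ig0 (Tm_invertible nu_prime c m).
have [Ca CaP] := hecke_approx nu_prime ig ih.
(* The distance [m + 6 (k + T + Ca)] reached below is [B + 6 T]. *)
pose B := (m + 6 * (k + Ca))%N.
have p1 : (1 < p)%N by case/andP: pF => /prime_gt1.
pose e := (2 * (B + 6 * Px)).+1.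
have qe : (e < p ^ e)%N by exact: ltn_expl.
set q := (p ^ e)%N in qe.
(* The largest number of periods of [cls h] for which this distance is at most [q]. *)
pose t := ((q - B) %/ (6 * Px))%N.
have t1 : (t * (6 * Px) <= q - B)%N by exact: leq_divM.
have t2 : (q - B < t * (6 * Px) + 6 * Px)%N.
  by rewrite addnC -mulSn; apply: ltn_ceil; rewrite muln_gt0.
pose T := (t * Px)%N; have TE : (t * (6 * Px) = 6 * T)%N by rewrite /T; lia.
have qT : (q <= 12 * T)%N by rewrite /e in qe; lia.
have [|b [a [A [a0 A1 hE]]]] := CaP (k + T)%N (k + T + Ca)%N; first by [].
set j := (k + T + Ca)%N in hE.
have j0 : (0 < 6 * j)%N by rewrite /j; rewrite /e in qe; lia.
have [c' c'c c'T] := Tm_jump c m b j0.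
exists c', (m + 6 * j)%N; split=> //; first by rewrite -addn1 leq_add2l.
move=> W Wi; set y := vertex nu g0 c' _.
have nq : (m + 6 * j <= q)%N by rewrite /j; rewrite /e /B in qe t1 TE; lia.
pose Q := (P0 * (C * q))%N.
have Q0 : (0 < Q)%N by rewrite !muln_gt0 P00 C0 /=; lia.
have py : period Q y by exact: vper.
have yE : y = mact A (tor a (cls h)) by rewrite -hE /y /vertex c'T lmapM mulmxA.
have cx := period_compact Px0 px; have cy := period_compact Q0 py.
have TQ : (T <= Q)%N.
  apply: (@leq_trans q); first by rewrite /e in qe; lia.
  by rewrite /Q mulnA leq_pmull// muln_gt0 P00.
have := shadow_measure Px0 Q0 cx cy (mu_orbit cx) (mu_orbit cy) px py Wi a0 A1 yE (leqnn _) TQ.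
apply: le_trans; rewrite lee_wpmul2r// lee_fin.
rewrite ler_pdivlMr ?ltr0n// mulrC ler_pdivrMr ?ltr0n ?muln_gt0 ?P00//.
by rewrite -natrM ler_nat /Q -/T; nia.
Qed.

End Approximation.

Lemma ray_walk (F : finFieldType) (e : hspace F -> hspace F -> Prop) (r : nat -> hspace F) :
  (forall n, e (r n) (r n.+1)) -> forall n i, walk e n (r i) (r (i + n)%N).
Proof.
move=> er; elim=> [|n IH] i; first by rewrite addn0; exact: walk0.
by apply: walkS (er i) _; rewrite addnS -addSn.
Qed.

Theorem theorem4 (R : realType) (F : finFieldType) (nu : {poly F})
    (x0 : hspace F) (mu : hspace F -> probability (borel F) R)
    (nu_prime : irreducible_poly nu)
    (x0_periodic : diag_periodic x0)
    (mu_orbit : forall x, diag_periodic x -> orbit_measure x (mu x)) :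
  exists2 c' : R, 0 < c' &
    forall x : hspace F, diag_periodic x ->
    exists2 xi, hecke_ends nu x0 xi &
    exists2 theta, Theta mu x0 xi theta &
      (forall E : set (borel F), measurable E ->
        (c'%:E * mu x E <= theta E)%E) /\
      (forall m : probability (borel F) R, homogeneous_measure m ->
        ~ theta `<< m).
Proof.
have [p _ pF] := finfield.finPcharP F.
have [g0 ig0 x0E] := cls_ex x0; rewrite {x0}x0E in x0_periodic *.
have [P0 P00 p0] := period_ex x0_periodic (mu_orbit _ x0_periodic).
have [C C0 vper] := vertex_period nu_prime pF ig0 p0.
have c0 : 0 < ((12 * (P0 * C))%:R^-1 : R) by rewrite invr_gt0 ltr0n !muln_gt0 P00.
exists (12 * (P0 * C))%:R^-1 => // x cx.
have [h ih xE] := cls_ex x; rewrite {x}xE in cx *.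
have [Px Px0 px] := period_ex cx (mu_orbit _ cx).
have shadow := vertex_shadow nu_prime pF ig0 ih mu_orbit P00 C0 Px0 vper px.
have [|c [n_ n_P]] := prolongation (fun=> 0) _ shadow.
  by move=> k c c' n cc' H W Wi; rewrite -(vertex_ext nu g0 cc'); exact: H.
pose r := vertex nu g0 c.
have rgeo : geodesic_ray nu r by exact: vertex_geodesic.
have r0 : r 0%N = cls g0 by exact: vertex0.
have [theta [thacc thdom]] := weak_limit (fun k => mu (r (n_ k))).
have dom E : measurable E -> (((12 * (P0 * C))%:R^-1 : R)%:E * mu (cls h) E <= theta E)%E.
  move=> mE; apply: thdom mE; first exact: ltW.
  move=> W [_ [s Wi]]; exists s => k sk; have [_] := n_P k; apply.
  exact: invariantW sk Wi.
exists (end_of nu r).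
  exists r => //; split=> // n; exists n; rewrite -r0.
  by apply: (ray_walk (r := r)) => i; exact: rgeo.1.
exists theta.
  exists r; first by split=> //; split=> //; exists 0%N, 0%N.
  split; first exact: thacc.1.
  move=> k f fK e N e0; have [l Nl fl] := thacc.2 k f fK e N e0.
  by exists (n_ l) => //; have [ln _] := n_P l; exact: leq_trans Nl ln.
split=> // m hm thm.
have mO : measurable (diag_orbit (cls h) : set (borel F)) by exact: compact_measurable_borel.
have m0 := homogeneous_diag_orbit hm Px0 px.
have th0 : theta (diag_orbit (cls h)) = 0%E.
  by move/null_content_dominatesP : thm; apply.
have := dom _ mO; rewrite th0 (mu_orbit _ cx).1 mule1 lee_fin.
by rewrite leNgt c0.
Qed.
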